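(* Let $G$ be a group. The crossed product by any twisted partial action of $G$ on an algebra is strongly-graded-equivalent to the skew group algebra of a product partial action of $G$ (on some algebra).
   Context: Algebras are associative, not necessarily unital, over a fixed commutative associative unital ring $k$; $G$ is an arbitrary group. Products of subsets such as $UV$ denote the $k$-span of all products $uv$. An algebra $A$ is idempotent if $A^2=A$. A bimodule ${}_RM_S$ is unital if $RM=M=MS$. A $G$-graded algebra is $A=\bigoplus_tA_t$ with $A_sA_t\subseteq A_{st}$. The multiplier algebra $\mathfrak M(I)$ of an algebra $I$ is the unital algebra of pairs $(L,R)$ with $L$ a right-$I$-module and $R$ a left-$I$-module endomorphism of $I$, such that $R(a)b=aL(b)$ for all $a,b$; product $(L,R)(L',R')=(LL',R'R)$. For $w=(L,R)$ write $wa=L(a)$, $aw=R(a)$. Twisted partial action (in the sense of Dokuchaev–Exel–Simón) of $G$ on $A$: a triple $(\{D_g\}_{g\in G},\{\alpha_g\}_{g\in G},\{w_{g,h}\}_{(g,h)\in G\times G})$ where each $D_g$ is a two-sided ideal of $A$, $\alpha_g:D_{g^{-1}}\to D_g$ is an algebra isomorphism, and $w_{g,h}$ is an invertible element of $\mathfrak M(D_gD_{gh})$, such that for all $g,h,t\in G$: (i) $D_g^2=D_g$, $D_gD_h=D_hD_g$; (ii) $D_1=A$ and $\alpha_1=\mathrm{id}_A$; (iii) $\alpha_g(D_{g^{-1}}D_h)=D_gD_{gh}$; (iv) $\alpha_g(\alpha_h(a))=w_{g,h}\alpha_{gh}(a)w_{g,h}^{-1}$ for $a\in D_{h^{-1}}D_{h^{-1}g^{-1}}$;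 (v) $w_{1,g}=w_{g,1}=1$; (vi) $\alpha_g(a\,w_{h,t})w_{g,ht}=\alpha_g(a)w_{g,h}w_{gh,t}$ for $a\in D_{g^{-1}}D_hD_{ht}$. Its crossed product is $\bigoplus_{g\in G}D_g\delta_g$ with $(a\delta_g)(b\delta_h)=\alpha_g(\alpha_g^{-1}(a)b)w_{g,h}\delta_{gh}$, an associative algebra, $G$-graded with $D_g\delta_g$ in degree $g$. A product partial action $\alpha$ of $G$ on an algebra $A$ is a family of two-sided ideals $D_t$ of $A$ and algebra isomorphisms $\alpha_t:D_{t^{-1}}\to D_t$ such that for all $s,t\in G$: (1) $\alpha_1=\mathrm{id}_A$; (2) $D_t^2=D_t$, $D_sD_t=D_tD_s$; (3) $\alpha_s(D_{s^{-1}}D_t)=D_sD_{st}$; (4) $\alpha_s(\alpha_t(x))=\alpha_{st}(x)$ for $x\in D_{t^{-1}}D_{(st)^{-1}}$. Its skew group algebra is $A\rtimes_\alpha G=\bigoplus_tD_t\delta_t$ with $(a\delta_r)(b\delta_s)=\alpha_r(\alpha_r^{-1}(a)b)\delta_{rs}$, $G$-graded with $D_t\delta_t$ in degree $t$. For a graded algebra $A$ put $D^A_t:=A_tA_{t^{-1}}$. A Morita context $(A,B,X,Y,\tau_A,\tau_B)$ consists of algebras $A,B$, an $(A,B)$-bimodule $X$, a $(B,A)$-bimodule $Y$, an $A$-bimodule map $\tau_A:X\otimes_BY\to A$ and a $B$-bimodule map $\tau_B:Y\otimes_AX\to B$ with $\tau_A(x\otimes y)x'=x\tau_B(y\otimes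 x')$ and $\tau_B(y\otimes x)y'=y\tau_A(x\otimes y')$. It is a graded Morita context between idempotent $G$-graded algebras $A,B$ if $X=\bigoplus_tX_t$, $Y=\bigoplus_tY_t$ are $G$-graded bimodules, and $\tau_A(X_r\otimes_B Y_s)\subseteq A_{rs}$, $\tau_B(Y_r\otimes_A X_s)\subseteq B_{rs}$ for all $r,s\in G$. Suppose all $D^A_t,D^B_t$ are idempotent. A graded Morita context is strong if each $X_t$ is a unital $(D^A_t,D^B_{t^{-1}})$-bimodule and each $Y_t$ is a unital $(D^B_t,D^A_{t^{-1}})$-bimodule. The idempotent graded algebras $A$ and $B$ are strongly-graded-equivalent if there is a strong graded Morita context with $\tau_A,\tau_B$ surjective such that, for all $t\in G$, the $k$-span of $\{\tau_A(x\otimes y):x\in X_t,y\in Y_{t^{-1}}\}$ is $D^A_t$ and the $k$-span of $\{\tau_B(y\otimes x):y\in Y_t,x\in X_{t^{-1}}\}$ is $D^B_t$. *)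

(* Defs.v *)
From HB Require Import structures.
From mathcomp Require Import all_boot all_order all_algebra.
From mathcomp Require Import all_classical.

Set Implicit Arguments.
Unset Strict Implicit.
Unset Printing Implicit Defensive.

Import GRing.Theory.
Local Open Scope classical_set_scope.
Local Open Scope ring_scope.

Declare Scope nualg_scope.
Delimit Scope nualg_scope with NU.

HB.mixin Record Lmodule_isNUAlgebra (k : comPzRingType) V
    of GRing.Lmodule k V := {
  numul : V -> V -> V;
  numulA : associative numul;
  numulPl : forall (c : k) (a b x : V),
    numul (c *: a + b) x = c *: numul a x + numul b x;
  numulPr : forall (c : k) (x a b : V),
    numul x (c *: a + b) = c *: numul x a + numul x b
}.

#[short(type="nuAlgType")]
HB.structure Definition NUAlgebra (k : comPzRingType) :=
  { V of GRing.Lmodule k V & Lmodule_isNUAlgebra k V }.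

Infix "**" := numul (at level 40, left associativity) : nualg_scope.
Local Open Scope nualg_scope.

Section Span.
Variable k : comPzRingType.

Definition submodule (V : lmodType k) (S : set V) : Prop :=
  S 0 /\ forall (c : k) u v, S u -> S v -> S (c *: u + v).

Definition span (V : lmodType k) (S : set V) : set V :=
  [set x | exists (n : nat) (c : 'I_n -> k) (v : 'I_n -> V),
    (forall i, S (v i)) /\ x = \sum_i c i *: v i].

(* For a "product" op, the k-span of all op u v with u in S and v in T. *)
Definition span2 (U V W : lmodType k) (op : U -> V -> W)
    (S : set U) (T : set V) : set W :=
  span [set op u v | u in S & v in T].

(* V is the internal direct sum of the submodules C t. *)
Definition direct_sum (I : eqType) (V : lmodType k) (C : I -> set V) : Prop :=
  [/\ forall t, submodule (C t),
      forall v, exists (s : seq I) (f : I -> V),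
        [/\ uniq s, forall t, C t (f t) & v = \sum_(t <- s) f t]
    & forall (s : seq I) (f : I -> V), uniq s -> (forall t, C t (f t)) ->
        \sum_(t <- s) f t = 0 -> forall t, t \in s -> f t = 0].

End Span.

(* The product ST of subsets of an algebra. *)
Notation "S `** T" := (span2 numul S T)
  (at level 40, left associativity) : nualg_scope.

Section Algebras.
Variables (k : comPzRingType).
Implicit Types A B : nuAlgType k.

Definition idempotent_alg A : Prop := [set: A] `** [set: A] = [set: A].

Definition two_sided_ideal A (I : set A) : Prop :=
  submodule I /\ forall a x, I x -> I (a ** x) /\ I (x ** a).

(* A map I -> J between ideals is represented by a total function of which
   only the restriction to I matters. *)
Definition ideal_iso A (I J : set A) (f : A -> A) : Prop :=
  [/\ set_bij I J f,
      forall (c : k) a b, I a -> I b -> f (c *: a + b) = c *: f a + f b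
    & forall a b, I a -> I b -> f (a ** b) = f a ** f b].

(* Elements of the multiplier algebra of I, as pairs of total functions of
   which only the restrictions to I matter: equality of multipliers is [meq]. *)
Record multiplier A (I : set A) := Multiplier {
  mulL : A -> A;
  mulR : A -> A;
  mulL_in : forall a, I a -> I (mulL a);
  mulR_in : forall a, I a -> I (mulR a);
  mulLP : forall (c : k) a b, I a -> I b ->
    mulL (c *: a + b) = c *: mulL a + mulL b;
  mulRP : forall (c : k) a b, I a -> I b ->
    mulR (c *: a + b) = c *: mulR a + mulR b;
  mulLM : forall a b, I a -> I b -> mulL (a ** b) = mulL a ** b;
  mulRM : forall a b, I a -> I b -> mulR (a ** b) = a ** mulR b;
  mulRL : forall a b, I a -> I b -> mulR a ** b = a ** mulL b
}.

Definition meq A (I : set A) (w w' : multiplier I) : Prop :=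
  forall a, I a -> mulL w a = mulL w' a /\ mulR w a = mulR w' a.

Definition mone A (I : set A) : multiplier I.
Proof. by exists id id. Defined.

Definition mmul A (I : set A) (w w' : multiplier I) : multiplier I.
Proof.
exists (mulL w \o mulL w') (mulR w' \o mulR w) => /=.
- by move=> a Ia; do 2!apply: mulL_in.
- by move=> a Ia; do 2!apply: mulR_in.
- by move=> c a b Ia Ib; rewrite !mulLP //; apply: mulL_in.
- by move=> c a b Ia Ib; rewrite !mulRP //; apply: mulR_in.
- by move=> a b Ia Ib; rewrite !mulLM //; apply: mulL_in.
- by move=> a b Ia Ib; rewrite !mulRM //; apply: mulR_in.
- move=> a b Ia Ib; rewrite mulRL //; last exact: mulR_in.
  by rewrite mulRL //; apply: mulL_in.
Defined.

Definition minverse A (I : set A) (w v : multiplier I) : Prop :=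
  meq (mmul w v) (mone I) /\ meq (mmul v w) (mone I).

End Algebras.

Section PartialActions.
Variables (k : comPzRingType) (G : groupType).

Record twisted_partial_action (A : nuAlgType k) := TwistedPartialAction {
  tdom : G -> set A;
  tact : G -> A -> A;
  twist : forall g h : G, multiplier (tdom g `** tdom (g * h)%g);
  tdom_ideal : forall g, two_sided_ideal (tdom g);
  tact_iso : forall g, ideal_iso (tdom g^-1%g) (tdom g) (tact g);
  twist_inv : forall g h, exists v, minverse (twist g h) v;
  tdom_idem : forall g, tdom g `** tdom g = tdom g;
  tdomC : forall g h, tdom g `** tdom h = tdom h `** tdom g;
  tdom1 : tdom 1%g = [set: A];
  tact1 : forall a, tact 1%g a = a;
  tact_dom : forall g h,
    tact g @` (tdom g^-1%g `** tdom h) = tdom g `** tdom (g * h)%g;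
  tactM : forall g h (v : multiplier (tdom g `** tdom (g * h)%g)) a,
    minverse (twist g h) v ->
    (tdom h^-1%g `** tdom (h^-1 * g^-1)%g) a ->
    tact g (tact h a) = mulR v (mulL (twist g h) (tact (g * h)%g a));
  twist1g : forall g, meq (twist 1%g g) (mone _);
  twistg1 : forall g, meq (twist g 1%g) (mone _);
  (* the cocycle identity
     alpha_g(a w_{h,t}) w_{g,ht} = alpha_g(a) w_{g,h} w_{gh,t} *)
  twist_cocycle : forall g h t a,
    (tdom g^-1%g `** tdom h `** tdom (h * t)%g) a ->
    mulR (twist g (h * t)%g) (tact g (mulR (twist h t) a)) =
    mulR (twist (g * h)%g t) (mulR (twist g h) (tact g a))
}.

Record product_partial_action (A : nuAlgType k) := ProductPartialAction {
  pdom : G -> set A;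
  pact : G -> A -> A;
  pdom_ideal : forall t, two_sided_ideal (pdom t);
  pact_iso : forall t, ideal_iso (pdom t^-1%g) (pdom t) (pact t);
  pdom1 : pdom 1%g = [set: A];
  pact1 : forall a, pact 1%g a = a;
  pdom_idem : forall t, pdom t `** pdom t = pdom t;
  pdomC : forall s t, pdom s `** pdom t = pdom t `** pdom s;
  pact_dom : forall s t,
    pact s @` (pdom s^-1%g `** pdom t) = pdom s `** pdom (s * t)%g;
  pactM : forall s t a, (pdom t^-1%g `** pdom (s * t)^-1%g) a ->
    pact s (pact t a) = pact (s * t)%g a
}.

Definition trivial_twist (A : nuAlgType k) (P : product_partial_action A) :
  twisted_partial_action A.
Proof.
exists (pdom P) (pact P) (fun g h => mone _) => //.
- exact: pdom_ideal.
- exact: pact_iso.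
- by move=> g h; exists (mone _).
- exact: pdom_idem.
- exact: pdomC.
- exact: pdom1.
- exact: pact1.
- exact: pact_dom.
- move=> g h v a [vw _]; rewrite -invgM => Da /=.
  rewrite pactM //; have [] // := vw (pact P (g * h) a).
  suff: (pact P (g * h) @` (pdom P (g * h)^-1 `** pdom P h^-1))%g
          (pact P (g * h) a).
    by rewrite pact_dom mulgK pdomC.
  by exists a; rewrite // pdomC.
Defined.

End PartialActions.

Section SpanTheory.
Variable k : comPzRingType.

Lemma submoduleD (V : lmodType k) (S : set V) u v :
  submodule S -> S u -> S v -> S (u + v).
Proof. by move=> [_ SP] Su Sv; rewrite -[u]scale1r; apply: SP. Qed.

Lemma submoduleZ (V : lmodType k) (S : set V) (c : k) u :
  submodule S -> S u -> S (c *: u).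
Proof. by move=> [S0 SP] Su; rewrite -[_ *: _]addr0; apply: SP. Qed.

Lemma submodule_sum (V : lmodType k) (S : set V) (I : Type) (r : seq I)
    (P : pred I) (f : I -> V) :
  submodule S -> (forall i, P i -> S (f i)) -> S (\sum_(i <- r | P i) f i).
Proof.
move=> mS Sf; elim/big_rec: _ => [|i x Pi Sx]; first by case: mS.
by apply: submoduleD => //; apply: Sf.
Qed.

Lemma mem_span (V : lmodType k) (S : set V) u : S u -> span S u.
Proof.
move=> Su; exists 1%N, (fun=> 1), (fun=> u); split=> //.
by rewrite big_ord1 scale1r.
Qed.

Lemma span_submodule (V : lmodType k) (S : set V) : submodule (span S).
Proof.
split; first by exists 0%N, (fun=> 0), (fun=> 0); rewrite big_ord0; split=> // -[].
move=> c u v [m [a [x [Sx ->]]]] [n [b [y [Sy ->]]]].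
exists (m + n)%N.
exists (fun i => match fintype.split i with inl j => c * a j | inr j => b j end).
exists (fun i => match fintype.split i with inl j => x j | inr j => y j end).
split=> [i|]; first by case: (fintype.split i).
rewrite big_split_ord /= scaler_sumr; congr (_ + _).
  by apply: eq_bigr => i _; rewrite (unsplitK (inl i)) scalerA.
by apply: eq_bigr => i _; rewrite (unsplitK (inr i)).
Qed.

Lemma span_min (V : lmodType k) (S S' : set V) :
  submodule S' -> S `<=` S' -> span S `<=` S'.
Proof.
move=> mS' sSS' _ [n [c [v [Sv ->]]]]; apply: submodule_sum => // i _.
by apply: submoduleZ => //; apply/sSS'/Sv.
Qed.

Lemma mem_span2 (U V W : lmodType k) (op : U -> V -> W) (S : set U)
  (T : set V) u v : S u -> T v -> span2 op S T (op u v).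
Proof. by move=> Su Tv; apply: mem_span; exists u => //; exists v. Qed.

Lemma span2_min (U V W : lmodType k) (op : U -> V -> W) (S : set U)
    (T : set V) (S' : set W) :
  submodule S' -> (forall u v, S u -> T v -> S' (op u v)) ->
  span2 op S T `<=` S'.
Proof.
by move=> mS' sub; apply: span_min => // _ [u Su [v Tv] <-]; apply: sub.
Qed.

End SpanTheory.

Section AlgebraTheory.
Variables (k : comPzRingType) (A : nuAlgType k).
Implicit Types (a b x y : A) (I J : set A).

Lemma numulDl a b x : (a + b) ** x = a ** x + b ** x.
Proof. by rewrite -[a]scale1r numulPl !scale1r. Qed.

Lemma numulDr x a b : x ** (a + b) = x ** a + x ** b.
Proof. by rewrite -[a]scale1r numulPr !scale1r. Qed.

Lemma numul0x x : 0 ** x = 0.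
Proof. by apply: (addrI (0 ** x)); rewrite -numulDl !addr0. Qed.

Lemma numulx0 x : x ** 0 = 0.
Proof. by apply: (addrI (x ** 0)); rewrite -numulDr !addr0. Qed.

Lemma numul_suml x (I : Type) (r : seq I) (f : I -> A) :
  (\sum_(i <- r) f i) ** x = \sum_(i <- r) f i ** x.
Proof.
apply: (big_morph (fun y => y ** x)); last exact: numul0x.
by move=> a b; apply: numulDl.
Qed.

Lemma numul_sumr x (I : Type) (r : seq I) (f : I -> A) :
  x ** (\sum_(i <- r) f i) = \sum_(i <- r) x ** f i.
Proof.
apply: (big_morph (fun y => x ** y)); last exact: numulx0.
by move=> a b; apply: numulDr.
Qed.

Lemma idealM I J : two_sided_ideal I -> two_sided_ideal J ->
  two_sided_ideal (I `** J).
Proof.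
move=> [mI iI] [mJ iJ]; split=> [|a x IJx]; first exact: span_submodule.
split; move: x IJx; apply: span2_min.
- split=> [|c u v /= Su Sv]; first by rewrite /= numulx0; apply: (span_submodule _).1.
  by rewrite numulPr; apply: (span_submodule _).2.
- by move=> u v Iu Jv /=; rewrite numulA; apply: mem_span2 => //; apply: (iI _ _ _).1.
- split=> [|c u v /= Su Sv]; first by rewrite /= numul0x; apply: (span_submodule _).1.
  by rewrite numulPl; apply: (span_submodule _).2.
- by move=> u v Iu Jv /=; rewrite -numulA; apply: mem_span2 => //; apply: (iJ _ _ _).2.
Qed.

Lemma ideal_mulSl I J : two_sided_ideal I -> I `** J `<=` I.
Proof. by move=> [mI iI]; apply: span2_min => // u v Iu _; apply: (iI _ _ _).2. Qed.

Lemma ideal_mulSr I J : two_sided_ideal J -> I `** J `<=` J.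
Proof. by move=> [mI iI]; apply: span2_min => // u v _ Iu; apply: (iI _ _ _).1. Qed.

Lemma ideal_mul_idem I J : two_sided_ideal I -> two_sided_ideal J ->
    I `** I = I -> J `** J = J -> I `** J = J `** I ->
  (I `** J) `** (I `** J) = I `** J.
Proof.
move=> iI iJ II JJ IJ; have iIJ := idealM iI iJ.
apply/seteqP; split; first exact: ideal_mulSl.
have mIJ := span_submodule [set u ** v | u in I `** J & v in I `** J].
apply: span2_min; first exact: mIJ.
move=> u v; rewrite -{1}II -{1}JJ => IIu.
move: v; apply: span2_min => [|v1 v2 Jv1 Jv2].
  split=> [|c x y ? ?]; first by rewrite numulx0; apply: mIJ.1.
  by rewrite numulPr; apply: mIJ.2.
move: u IIu; apply: span2_min => [|u1 u2 Iu1 Iu2].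
  split=> [|c x y ? ?]; first by rewrite numul0x; apply: mIJ.1.
  by rewrite numulPl; apply: mIJ.2.
rewrite numulA -(numulA u1).
have : (J `** I) (u2 ** v1) by rewrite -IJ; apply: mem_span2.
move: (u2 ** v1); apply: span2_min => [|y x Jy Ix].
  split=> [|c x y Sx Sy]; first by rewrite numulx0 numul0x; apply: mIJ.1.
  by rewrite numulPr numulPl; apply: mIJ.2.
by rewrite numulA -numulA; apply: mem_span2; apply: mem_span2.
Qed.

Lemma mulR_extr I (w : multiplier I) : two_sided_ideal I -> I `** I = I ->
  forall a y, I y -> mulR w (a ** y) = a ** mulR w y.
Proof.
move=> [mI iI] II a y; rewrite -{1}II => IIy.
suff [] : I y /\ mulR w (a ** y) = a ** mulR w y by [].
have w0 : mulR w 0 = 0.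
  have := @mulRP _ _ _ w (-1) 0 0 mI.1 mI.1.
  by rewrite scaler0 addr0 scaleN1r addNr.
move: y IIy; apply: span2_min => [|p q Ip Iq].
  split=> [|c x y [Ix ex] [Iy ey]].
    by split; [apply: mI.1 | rewrite !(numulx0, w0)].
  split; first exact: mI.2.
  by rewrite numulPr !mulRP ?ex ?ey ?numulPr //; apply: (iI _ _ _).1.
split; first exact: (iI _ _ _).1.
by rewrite numulA !mulRM ?numulA //; apply: (iI _ _ _).1.
Qed.

End AlgebraTheory.

Section CrossedProduct.
Variables (k : comPzRingType) (G : groupType) (A : nuAlgType k).
Variable T : twisted_partial_action G A.

(* alpha_g^-1 : D_g -> D_(g^-1) *)
Definition tactV (g : G) : A -> A :=
  'pinv_(fun=> 0) (tdom T g^-1%g) (tact T g).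

(* (a delta_g)(b delta_h) = crossed_coef g h a b delta_gh *)
Definition crossed_coef (g h : G) (a b : A) : A :=
  mulR (twist T g h) (tact T g (tactV g a ** b)).

Notation D := (tdom T).
Notation al := (tact T).
Notation iD := (tdom_ideal T).

Let mD g : submodule (D g). Proof. by case: (iD g). Qed.
Let D0 g : D g 0. Proof. by case: (mD g). Qed.
Let DMl g a x : D g x -> D g (a ** x).
Proof. by case: (iD g) => _ H /(H a) []. Qed.
Let DMr g a x : D g x -> D g (x ** a).
Proof. by case: (iD g) => _ H /(H a) []. Qed.
Let iDD g h : two_sided_ideal (D g `** D h).
Proof. by apply: idealM; apply: tdom_ideal. Qed.
Let DDM g h : (D g `** D h) `** (D g `** D h) = D g `** D h.
Proof.
apply: ideal_mul_idem; [exact: iD|exact: iD|exact: tdom_idem|exact: tdom_idem|].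
exact: tdomC.
Qed.
Let DDl g h x : (D g `** D h) x -> D g x.
Proof. by apply: ideal_mulSl; apply: tdom_ideal. Qed.
Let DDr g h x : (D g `** D h) x -> D h x.
Proof. by apply: ideal_mulSr; apply: tdom_ideal. Qed.

Let al_in g x : D g^-1%g x -> D g (al g x).
Proof. by case: (tact_iso T g) => -[+ _ _] _ _ => /[apply]. Qed.

Let alP g c x y : D g^-1%g x -> D g^-1%g y ->
  al g (c *: x + y) = c *: al g x + al g y.
Proof. by case: (tact_iso T g) => _ + _ => /[apply]/[apply]. Qed.

Let alM g x y : D g^-1%g x -> D g^-1%g y -> al g (x ** y) = al g x ** al g y.
Proof. by case: (tact_iso T g) => _ _ => /[apply]/[apply]. Qed.

Lemma tactK g x : D g^-1%g x -> tactV g (al g x) = x.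
Proof.
move=> Dx; rewrite /tactV pinvKV ?inE //.
by case: (tact_iso T g) => -[].
Qed.

Let al_ex g y : D g y -> exists2 x, D g^-1%g x & al g x = y.
Proof. by case: (tact_iso T g) => -[_ _ +] _ _ => /[apply]. Qed.

Lemma tactV_in g y : D g y -> D g^-1%g (tactV g y).
Proof. by move=> /al_ex[x Dx <-]; rewrite tactK. Qed.

Lemma tactVK g y : D g y -> al g (tactV g y) = y.
Proof. by move=> /al_ex[x Dx <-]; rewrite tactK. Qed.

Let alVP g c x y : D g x -> D g y ->
  tactV g (c *: x + y) = c *: tactV g x + tactV g y.
Proof.
move=> /al_ex[x' Dx <-] /al_ex[y' Dy <-].
by rewrite -alP // !tactK //; apply: (mD _).2.
Qed.

Let alVM g x y : D g x -> D g y -> tactV g (x ** y) = tactV g x ** tactV g y.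
Proof.
move=> /al_ex[x' Dx <-] /al_ex[y' Dy <-].
by rewrite -alM // !tactK //; apply: DMl.
Qed.

Let al0 g : al g 0 = 0.
Proof.
have := @alP g (-1) 0 0 (D0 _) (D0 _).
by rewrite scaler0 addr0 scaleN1r addNr.
Qed.

Let al_DD g h x : (D g^-1%g `** D h) x -> (D g `** D (g * h)%g) (al g x).
Proof. by move=> Dx; rewrite -tact_dom; exists x. Qed.

Let alV_DD g h x : (D g `** D (g * h)%g) x -> (D g^-1%g `** D h) (tactV g x).
Proof. by rewrite -tact_dom => -[y Dy <-]; rewrite tactK //; apply: DDl Dy. Qed.

Let wR g h := @mulR_extr _ _ _ (twist T g h) (iDD _ _) (DDM _ _).

Let coef_arg g h a b : D g a -> D h b -> (D g^-1%g `** D h) (tactV g a ** b).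
Proof. by move=> /tactV_in Da Db; apply: mem_span2. Qed.

Lemma crossed_coef_in g h a b : D g a -> D h b ->
  D (g * h)%g (crossed_coef g h a b).
Proof.
move=> Da Db; apply: (@DDr g); apply: mulR_in; apply: al_DD; exact: coef_arg Da Db.
Qed.

Lemma crossed_coefPl g h c a a' b : D g a -> D g a' -> D h b ->
  crossed_coef g h (c *: a + a') b =
  c *: crossed_coef g h a b + crossed_coef g h a' b.
Proof.
move=> Da Da' Db; rewrite /crossed_coef alVP // numulPl.
have ab := coef_arg Da Db; have a'b := coef_arg Da' Db.
rewrite alP ?mulRP //; by [apply: al_DD | apply: DDl; eassumption].
Qed.

Lemma crossed_coefPr g h c a b b' : D g a -> D h b -> D h b' ->
  crossed_coef g h a (c *: b + b') =
  c *: crossed_coef g h a b + crossed_coef g h a b'.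
Proof.
move=> Da Db Db'; rewrite /crossed_coef numulPr.
have ab := coef_arg Da Db; have ab' := coef_arg Da Db'.
rewrite alP ?mulRP //; by [apply: al_DD | apply: DDl; eassumption].
Qed.

Lemma crossed_coef0l g h b : D h b -> crossed_coef g h 0 b = 0.
Proof.
move=> Db; have := @crossed_coefPl g h (-1) 0 0 b (D0 _) (D0 _) Db.
by rewrite scaler0 addr0 scaleN1r addNr.
Qed.

Lemma crossed_coef0r g h a : D g a -> crossed_coef g h a 0 = 0.
Proof.
move=> Da; have := @crossed_coefPr g h (-1) a 0 0 Da (D0 _) (D0 _).
by rewrite scaler0 addr0 scaleN1r addNr.
Qed.

(* alpha_g(alpha_h(z)) w_{g,h} = w_{g,h} alpha_gh(z) *)
Let al_comp g h z : (D h^-1%g `** D (h^-1 * g^-1)%g) z ->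
  mulR (twist T g h) (al g (al h z)) = mulL (twist T g h) (al (g * h)%g z).
Proof.
move=> Dz; have [v wv] := twist_inv T g h; rewrite (tactM wv Dz).
have [_ vw] := wv.
have Dgz : (D g `** D (g * h)%g) (al (g * h)%g z).
  rewrite tdomC -[X in _ `** D X](mulgK h g) //; apply: al_DD.
  by rewrite tdomC invgM.
by have [_ /= ->] := vw _ (mulL_in (twist T g h) Dgz).
Qed.

(* The key step of associativity, after Dokuchaev, Exel and Simon. *)
Let key g h y c : (D g^-1%g `** D h) y ->
  mulR (twist T g h) (al g (al h (tactV h y ** c))) =
  al (g * h)%g (tactV (g * h)%g (mulR (twist T g h) (al g y)) ** c).
Proof.
move=> Dy; set z := tactV h y.
have Dz : (D h^-1%g `** D (h^-1 * g^-1)%g) z.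
  by apply: alV_DD; rewrite mulVKg tdomC.
have Dhy : D h y by apply: DDr Dy.
rewrite -[y in RHS](@tactVK h) // -/z.
set J := D h^-1%g `** D (h^-1 * g^-1)%g in Dz.
have iJ : two_sided_ideal J by apply: iDD.
have JM x d : J x -> J (x ** d) by case: iJ => _ H /(H d) [].
rewrite !al_comp //; last exact: JM.
have JI x : J x -> (D g `** D (g * h)%g) (al (g * h)%g x).
  move=> Jx; rewrite tdomC -[X in _ `** D X](mulgK h g) //; apply: al_DD.
  by rewrite tdomC invgM.
have JD x : J x -> D (g * h)^-1%g x by rewrite invgM; apply: DDr.
set w := twist T g h.
have wI x : J x -> D (g * h)%g (mulL w (al (g * h)%g x)).
  by move=> /JI /(mulL_in w) /DDr.
have [J0 JP] := iJ.1.
suff [] : J z /\ mulL w (al (g * h)%g (z ** c)) =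
  al (g * h)%g (tactV (g * h)%g (mulL w (al (g * h)%g z)) ** c) by [].
have : (J `** J) z by rewrite /J DDM.
move: (z); apply: span2_min => [|p q Jp Jq].
  have VD x : J x ->
      D (g * h)^-1%g (tactV (g * h)%g (mulL w (al (g * h)%g x)) ** c).
    by move=> Jx; apply/DMr/tactV_in/wI.
  split=> [|d x x' [Jx ex] [Jx' ex']].
    split=> //; rewrite numul0x !al0.
    have w0 : mulL w 0 = 0.
      have := @mulLP _ _ _ w (-1) 0 0 (iDD _ _).1.1 (iDD _ _).1.1.
      by rewrite scaler0 addr0 scaleN1r addNr.
    rewrite w0; have := @alVP (g * h)%g (-1) 0 0 (D0 _) (D0 _).
    by rewrite scaler0 addr0 scaleN1r addNr => ->; rewrite numul0x al0.
  have Jxc := JM _ c Jx; have Jxc' := JM _ c Jx'.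
  split; first exact: JP.
  rewrite numulPl !alP ?mulLP ?ex ?ex' ?alVP ?numulPl ?alP //;
    by [apply: JI | apply: JD | apply: wI | apply: VD].
have Jqc := JM _ c Jq.
split; first exact: JM.
have [[Ip Iq] Iqc] := (JI _ Jp, JI _ Jq, JI _ Jqc).
have [[Dp Dq] Dqc] := (JD _ Jp, JD _ Jq, JD _ Jqc).
have Wp := wI _ Jp; have Vp := tactV_in Wp.
rewrite -numulA (alM Dp Dqc) mulLM // (alM Dp Dq) mulLM // alVM //; last first.
  exact: DDr Iq.
by rewrite (tactK Dq) -numulA (alM Vp Dqc) tactVK.
Qed.

Lemma crossed_coefA g h t a b c : D g a -> D h b -> D t c ->
  crossed_coef g (h * t)%g a (crossed_coef h t b c) =
  crossed_coef (g * h)%g t (crossed_coef g h a b) c.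
Proof.
move=> Da Db Dc; rewrite {1}/crossed_coef.
set a' := tactV g a; set b' := tactV h b.
have Da' : D g^-1%g a' by apply: tactV_in.
have Db' : D h^-1%g b' by apply: tactV_in.
have Dbc := coef_arg Db Dc.
have Dx := al_DD Dbc.
rewrite {2}/crossed_coef -wR // twist_cocycle; last first.
  set x := al h _ in Dx *.
  suff : (D g^-1%g `** (D h `** D (h * t)%g)) (a' ** x).
    move: (a' ** x); apply: span2_min; first exact: span_submodule.
    move=> u v Du; move: v; apply: span2_min.
      have [S0 SP] := span_submodule
        [set p ** q | p in D g^-1%g `** D h & q in D (h * t)%g].
      split=> [|d p q Sp Sq]; first by rewrite numulx0.
      by rewrite numulPr; apply: SP.
    by move=> p q Dp Dq; rewrite numulA; apply: mem_span2 => //; apply: mem_span2.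
  exact: mem_span2.
rewrite {1}/crossed_coef; congr mulR.
rewrite /crossed_coef -/a' -/b' -key; last exact: mem_span2.
congr (mulR _ (al g _)).
have DbbE : b = al h b' by rewrite tactVK.
rewrite DbbE; move: Db'; rewrite -{1}tdom_idem => Db'.
suff [] : D h^-1%g b' /\
  a' ** al h (b' ** c) = al h (tactV h (a' ** al h b') ** c) by [].
move: b' Db' {Dbc Dx DbbE}; apply: span2_min => [|p q Dp Dq].
  have VD x : D h^-1%g x -> D h (a' ** al h x).
    by move=> Dx; apply/DMl/al_in.
  split=> [|d x y [Dx ex] [Dy ey]].
    split=> //; rewrite numul0x !al0 numulx0.
    have := @alVP h (-1) 0 0 (D0 _) (D0 _).
    by rewrite scaler0 addr0 scaleN1r addNr => ->; rewrite numul0x al0.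
  split; first exact: (mD _).2.
  have Vx := VD _ Dx; have Vy := VD _ Dy.
  rewrite numulPl !alP ?numulPr ?ex ?ey ?alVP ?numulPl ?alP //;
    by [apply: DMr | apply/DMr/tactV_in].
split; first exact: DMl.
have Dqc := DMr c Dq; have Dap := DMl a' (al_in Dp); have Vap := tactV_in Dap.
rewrite -numulA (alM Dp Dqc) (alM Dp Dq) !numulA alVM //; last exact: al_in.
by rewrite (tactK Dq) -(numulA _ q c) (alM Vap Dqc) tactVK.
Qed.

(* The direct sum of the D_g delta_g: finitely supported families of
   elements of the D_g. *)
Definition crossed_pred : {pred G -> A} := fun f =>
  `[< finite_set [set g | f g <> 0] /\ forall g, tdom T g (f g) >].

Record crossed := Crossed {
  crossed_val :> G -> A;
  _ : crossed_val \in crossed_pred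
}.

Fact crossed_submod_closed : GRing.submod_closed crossed_pred.
Proof.
split.
  apply/asboolP; split=> [|g]; last exact: D0.
  suff -> : [set g | (0 : G -> A) g <> 0] = set0 by [].
  by apply/seteqP; split=> g.
move=> c f f' /asboolP[ff Df] /asboolP[ff' Df']; apply/asboolP; split=> [|g].
  apply: (@sub_finite_set _ _ ([set g | f g <> 0] `|` [set g | f' g <> 0])).
    move=> g /= H; apply: contrapT => /not_orP[/contrapT e /contrapT e'].
    apply: H; change (c *: f g + f' g = 0).
    by rewrite e e' scaler0 addr0.
  by rewrite finite_setU.
exact: (mD g).2.
Qed.

HB.instance Definition _ := GRing.isSubmodClosed.Build k (G -> A) crossed_pred
  crossed_submod_closed.

HB.instance Definition _ := [isSub for crossed_val].
HB.instance Definition _ := [Choice of crossed by <:].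
HB.instance Definition _ := [SubChoice_isSubLmodule of crossed by <:].

Implicit Types x y z : crossed.

Lemma crossed_in x g : tdom T g (x g).
Proof. by case: x => f /= /asboolP[]. Qed.

Lemma crossed_fin x : finite_set [set g | x g <> 0].
Proof. by case: x => f /= /asboolP[]. Qed.

Lemma crossedP x y : (forall g, x g = y g) -> x = y.
Proof. by move=> xy; apply/val_inj/funext. Qed.

Lemma crossed_PE (c : k) x y g : (c *: x + y : crossed) g = c *: x g + y g.
Proof. by rewrite -[crossed_val _]/(val _) linearP. Qed.

Lemma crossed_DE x y g : (x + y : crossed) g = x g + y g.
Proof. by []. Qed.

Lemma crossed0E g : (0 : crossed) g = 0.
Proof. by []. Qed.

Lemma crossed_sumE (I : Type) (r : seq I) (f : I -> crossed) g :
  (\sum_(i <- r) f i) g = \sum_(i <- r) f i g.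
Proof. by apply: (big_morph (fun x : crossed => x g)). Qed.

(* The coefficient of delta_t in xy is the sum of the coefficients of the
   (x_g delta_g)(y_h delta_h) over all g, h with gh = t. *)
Definition crossed_mul_fun x y (t : G) : A :=
  \sum_(g \in [set: G]) crossed_coef g (g^-1 * t)%g (x g) (y (g^-1 * t)%g).

Lemma crossed_supp x : exists2 r : seq G, uniq r & forall g, g \notin r -> x g = 0.
Proof.
have [r xr] := (finite_seqP _).1 (crossed_fin x).
exists (undup r) => [|g]; first exact: undup_uniq.
rewrite mem_undup => /negP gr; apply: contrapT => xg; apply: gr.
suff : [set` r] g by [].
by rewrite -xr.
Qed.

Lemma crossed_mul_funE x y t (r : seq G) :
  uniq r -> (forall g, g \notin r -> x g = 0) ->
  crossed_mul_fun x y t =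
  \sum_(g <- r) crossed_coef g (g^-1 * t)%g (x g) (y (g^-1 * t)%g).
Proof.
move=> ur rx; rewrite /crossed_mul_fun (fsbigE r) //.
  by apply: eq_bigl => g; rewrite in_setT.
by move=> g _ /rx ->; rewrite crossed_coef0l //; apply: crossed_in.
Qed.

Fact crossed_mul_in x y : crossed_mul_fun x y \in crossed_pred.
Proof.
have [r ur rx] := crossed_supp x; have [s us sy] := crossed_supp y.
apply/asboolP; split=> [|t].
  apply: (@sub_finite_set _ _ [set` [seq (g * h)%g | g <- r, h <- s]]) => //.
  move=> t /= Ht; apply/negP => /negP nt; apply: Ht.
  rewrite (crossed_mul_funE _ _ ur) // big_seq big1 // => g gr.
  rewrite sy ?crossed_coef0r //; first exact: crossed_in.
  by apply: contra nt => gs; apply/allpairsP; exists (g, g^-1 * t)%g;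
    split; rewrite //= mulVKg.
rewrite (crossed_mul_funE _ _ ur) //; apply: submodule_sum => // g _.
by rewrite -[X in D X](mulVKg g); apply: crossed_coef_in; apply: crossed_in.
Qed.

Definition crossed_mul x y : crossed := Crossed (crossed_mul_in x y).

Lemma crossed_mulE x y t (r : seq G) :
  uniq r -> (forall g, g \notin r -> x g = 0) ->
  crossed_mul x y t =
  \sum_(g <- r) crossed_coef g (g^-1 * t)%g (x g) (y (g^-1 * t)%g).
Proof. exact: crossed_mul_funE. Qed.

Lemma crossed_mulPl (c : k) x y z :
  crossed_mul (c *: x + y) z = c *: crossed_mul x z + crossed_mul y z.
Proof.
have [r ur rx] := crossed_supp x; have [s us sy] := crossed_supp y.
have uu := undup_uniq (r ++ s).
have ux g : g \notin undup (r ++ s) -> x g = 0.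
  by rewrite mem_undup mem_cat => /norP[/rx].
have uy g : g \notin undup (r ++ s) -> y g = 0.
  by rewrite mem_undup mem_cat => /norP[_ /sy].
apply: crossedP => t; rewrite crossed_PE.
rewrite (crossed_mulE z t uu ux) (crossed_mulE z t uu uy).
rewrite (crossed_mulE z t uu); last first.
  by move=> g gu; rewrite crossed_PE ux // uy // scaler0 addr0.
rewrite scaler_sumr -big_split; apply: eq_bigr => g _.
by rewrite crossed_PE crossed_coefPl //; apply: crossed_in.
Qed.

Lemma crossed_mulPr (c : k) z x y :
  crossed_mul z (c *: x + y) = c *: crossed_mul z x + crossed_mul z y.
Proof.
have [r ur rz] := crossed_supp z.
apply: crossedP => t; rewrite crossed_PE !(crossed_mulE _ _ ur rz).
rewrite scaler_sumr -big_split; apply: eq_bigr => g _.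
by rewrite crossed_PE crossed_coefPr //; apply: crossed_in.
Qed.

(* a delta_g (meaningful for a in D_g only) *)
Definition delta (g : G) (a : A) : crossed :=
  insubd 0 (fun h => if h == g then a else 0).

Lemma deltaE g a h : D g a -> delta g a h = if h == g then a else 0.
Proof.
move=> Da; rewrite /delta -[crossed_val _]/(val _) insubdK //.
apply/asboolP; split=> [|t]; last by case: eqP => [->|].
apply: (@sub_finite_set _ _ [set g]) => // t /=.
by case: eqP => // -> _.
Qed.

Lemma crossed_decomp x (r : seq G) : uniq r ->
  (forall g, g \notin r -> x g = 0) -> x = \sum_(g <- r) delta g (x g).
Proof.
move=> ur rx; apply: crossedP => t; rewrite crossed_sumE.
rewrite (eq_bigr (fun g => if t == g then x g else 0)); last first.
  by move=> g _; apply: deltaE; apply: crossed_in.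
case tr: (t \in r); last first.
  rewrite rx ?tr // big_seq big1 // => g gr.
  by case: eqP => // tg; rewrite -tg tr in gr.
rewrite (big_rem t) //= eqxx big_seq big1 ?addr0 // => g.
by rewrite mem_rem_uniq // inE eq_sym => /andP[/negPf ->].
Qed.

Lemma delta_mul g h a b : D g a -> D h b ->
  crossed_mul (delta g a) (delta h b) =
  delta (g * h)%g (mulR (twist T g h) (tact T g (tactV g a ** b))).
Proof.
move=> Da Db; apply: crossedP => t.
rewrite (@crossed_mulE _ _ _ [:: g]) //; last first.
  by move=> s; rewrite inE deltaE // => /negPf ->.
rewrite big_seq1 !deltaE ?eqxx //; last exact: crossed_coef_in.
rewrite -[LHS]/(crossed_coef _ _ _ _) -/(crossed_coef g h a b).
have -> : (g^-1 * t == h)%g = (t == g * h)%g.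
  by apply/eqP/eqP => [<-|->]; rewrite ?mulVKg ?mulKg.
by case: eqP => [->|_]; rewrite ?mulKg // crossed_coef0r.
Qed.

Lemma crossed_mul_suml (I : Type) (r : seq I) (f : I -> crossed) y :
  crossed_mul (\sum_(i <- r) f i) y = \sum_(i <- r) crossed_mul (f i) y.
Proof.
have addM x z : crossed_mul (x + z) y = crossed_mul x y + crossed_mul z y.
  by rewrite -[x]scale1r crossed_mulPl !scale1r.
apply: (big_morph (crossed_mul^~ y)) => //.
by apply: (addrI (crossed_mul 0 y)); rewrite -addM !addr0.
Qed.

Lemma crossed_mul_sumr (I : Type) (r : seq I) (f : I -> crossed) y :
  crossed_mul y (\sum_(i <- r) f i) = \sum_(i <- r) crossed_mul y (f i).
Proof.
have addM x z : crossed_mul y (x + z) = crossed_mul y x + crossed_mul y z.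
  by rewrite -[x]scale1r crossed_mulPr !scale1r.
apply: (big_morph (crossed_mul y)) => //.
by apply: (addrI (crossed_mul y 0)); rewrite -addM !addr0.
Qed.

Lemma crossed_mulA : associative crossed_mul.
Proof.
move=> x y z.
have [r ur rx] := crossed_supp x; have [s us sy] := crossed_supp y.
have [u uu uz] := crossed_supp z.
rewrite (crossed_decomp ur rx) (crossed_decomp us sy) (crossed_decomp uu uz).
rewrite !crossed_mul_suml; apply: eq_bigr => g _.
rewrite !(crossed_mul_sumr _ _ (delta g _)) crossed_mul_suml.
apply: eq_bigr => h _.
rewrite !crossed_mul_sumr; apply: eq_bigr => t _.
have [[xg yh] zt] := (crossed_in x g, crossed_in y h, crossed_in z t).
rewrite !delta_mul //; try exact: crossed_coef_in.
have E := crossed_coefA xg yh zt; rewrite /crossed_coef in E.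
by rewrite E (mulgA g h t).
Qed.

HB.instance Definition _ := Lmodule_isNUAlgebra.Build k crossed
  crossed_mulA crossed_mulPl crossed_mulPr.

(* D_t delta_t *)
Definition crossed_gr (t : G) : set crossed :=
  [set x | forall g, g != t -> x g = 0].

End CrossedProduct.

Section GradedAlgebras.
Variables (k : comPzRingType) (G : groupType).

Record graded_algebra := GradedAlgebra {
  gr_alg :> nuAlgType k;
  gr : G -> set gr_alg;
  gr_direct : direct_sum gr;
  gr_mul : forall s t a b, gr s a -> gr t b -> gr (s * t)%g (a ** b)
}.

Arguments gr : clear implicits.

Definition gr_dom (A : graded_algebra) (t : G) : set A :=
  gr A t `** gr A t^-1%g.

Section CrossedProductGrading.
Variables (A : nuAlgType k) (T : twisted_partial_action G A).

Fact crossed_gr_direct : direct_sum (@crossed_gr k G A T).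
Proof.
split=> [t|x|s f us fC f0 t ts].
- split=> [g _ //|c x y x0 y0 g gt].
  by rewrite crossed_PE x0 // y0 // scaler0 addr0.
- have [r ur rx] := crossed_supp x.
  exists r, (fun g => delta T g (x g)); split=> //; last exact: crossed_decomp.
  move=> t g /negPf gt; rewrite deltaE ?gt //; exact: crossed_in.
- apply: crossedP => g; have [->|gt] := eqVneq g t; last exact: fC.
  have := congr1 (fun x : crossed T => x t) f0; rewrite /= crossed_sumE.
  rewrite (big_rem t) //= big_seq big1 ?addr0 // => h.
  by rewrite mem_rem_uniq // inE => /andP[ht _]; apply: fC; rewrite eq_sym.
Qed.

Fact crossed_gr_mul s t (x y : crossed T) :
  crossed_gr s x -> crossed_gr t y -> crossed_gr (s * t)%g (x ** y).
Proof.
move=> xs yt g gst; rewrite -[x ** y]/(crossed_mul x y).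
rewrite (@crossed_mulE _ _ _ _ _ _ _ [:: s]) //; last first.
  by move=> h; rewrite inE; apply: xs.
rewrite big_seq1 yt ?crossed_coef0r //; first exact: crossed_in.
by apply: contra gst => /eqP <-; rewrite mulVKg.
Qed.

Definition crossed_product : graded_algebra :=
  GradedAlgebra crossed_gr_direct crossed_gr_mul.

End CrossedProductGrading.

(* The crossed product with all w_{g,h} = 1: its product is
   (a delta_r)(b delta_s) = alpha_r(alpha_r^-1(a) b) delta_rs. *)
Definition skew_group_algebra (A : nuAlgType k)
    (P : product_partial_action G A) : graded_algebra :=
  crossed_product (trivial_twist P).

Lemma skew_group_algebra_mul (A : nuAlgType k)
    (P : product_partial_action G A) (r s : G) (a b : A) :
  pdom P r a -> pdom P s b ->
  (delta (trivial_twist P) r a : skew_group_algebra P) **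
    delta (trivial_twist P) s b =
  delta (trivial_twist P) (r * s)%g
    (pact P r ('pinv_(fun=> 0) (pdom P r^-1%g) (pact P r) a ** b)).
Proof. by move=> Da Db; apply: (@delta_mul _ _ _ (trivial_twist P)). Qed.

End GradedAlgebras.

Arguments gr {k G} g t _.
Arguments gr_dom {k G} A t _.

Section MoritaContexts.
Variable k : comPzRingType.

Record bimodule (A B : nuAlgType k) := Bimodule {
  bimod :> lmodType k;
  lact : A -> bimod -> bimod;
  ract : bimod -> B -> bimod;
  lactPl : forall (c : k) a a' x,
    lact (c *: a + a') x = c *: lact a x + lact a' x;
  lactPr : forall (c : k) a x x',
    lact a (c *: x + x') = c *: lact a x + lact a x';
  ractPl : forall (c : k) x x' b,
    ract (c *: x + x') b = c *: ract x b + ract x' b;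
  ractPr : forall (c : k) x b b',
    ract x (c *: b + b') = c *: ract x b + ract x b';
  lactA : forall a a' x, lact (a ** a') x = lact a (lact a' x);
  ractA : forall x b b', ract x (b ** b') = ract (ract x b) b';
  lractA : forall a x b, ract (lact a x) b = lact a (ract x b)
}.

(* A bimodule map X (x)_B Y -> A is given by the corresponding k-bilinear
   B-balanced map X -> Y -> A. *)
Definition balanced_bimodule_map (A B : nuAlgType k) (X : bimodule A B)
    (Y : bimodule B A) (tau : X -> Y -> A) : Prop :=
  (forall (c : k) x x' y, tau (c *: x + x') y = c *: tau x y + tau x' y) /\
  (forall (c : k) x y y', tau x (c *: y + y') = c *: tau x y + tau x y') /\
  (forall x b y, tau (ract x b) y = tau x (lact b y)) /\
  (forall a x y, tau (lact a x) y = a ** tau x y) /\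
  (forall x y a, tau x (ract y a) = tau x y ** a).

Record morita_context (A B : nuAlgType k) := MoritaContext {
  mcX : bimodule A B;
  mcY : bimodule B A;
  tauA : mcX -> mcY -> A;
  tauB : mcY -> mcX -> B;
  tauA_map : balanced_bimodule_map tauA;
  tauB_map : balanced_bimodule_map tauB;
  tauAB : forall x y x', lact (tauA x y) x' = ract x (tauB y x');
  tauBA : forall y x y', lact (tauB y x) y' = ract y (tauA x y')
}.

Variable G : groupType.

Definition graded_bimodule (A B : graded_algebra k G) (X : bimodule A B)
    (X_ : G -> set X) : Prop :=
  [/\ direct_sum X_,
      forall s t a x, gr A s a -> X_ t x -> X_ (s * t)%g (lact a x)
    & forall s t x b, X_ s x -> gr B t b -> X_ (s * t)%g (ract x b)].

Definition graded_morita_context (A B : graded_algebra k G)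
    (C : morita_context A B) (X_ : G -> set (mcX C)) (Y_ : G -> set (mcY C)) :
    Prop :=
  [/\ graded_bimodule X_, graded_bimodule Y_,
      forall r s x y, X_ r x -> Y_ s y -> gr A (r * s)%g (tauA x y)
    & forall r s y x, Y_ r y -> X_ s x -> gr B (r * s)%g (tauB y x)].

(* X_t is a unital (D^A_t, D^B_(t^-1))-bimodule. *)
Definition unital_component (A B : graded_algebra k G) (X : bimodule A B)
    (X_ : G -> set X) (t : G) : Prop :=
  span2 (@lact _ _ X) (gr_dom A t) (X_ t) = X_ t /\
  span2 (@ract _ _ X) (X_ t) (gr_dom B t^-1%g) = X_ t.

Definition strong_context (A B : graded_algebra k G)
    (C : morita_context A B) (X_ : G -> set (mcX C)) (Y_ : G -> set (mcY C)) :
    Prop :=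
  forall t, unital_component X_ t /\ unital_component Y_ t.

Definition strongly_graded_equivalent (A B : graded_algebra k G) : Prop :=
  [/\ idempotent_alg A, idempotent_alg B,
      forall t, gr_dom A t `** gr_dom A t = gr_dom A t /\
                gr_dom B t `** gr_dom B t = gr_dom B t
    & exists (C : morita_context A B)
             (X_ : G -> set (mcX C)) (Y_ : G -> set (mcY C)),
        graded_morita_context X_ Y_ /\ strong_context X_ Y_ /\
        span2 (@tauA _ _ C) [set: mcX C] [set: mcY C] = [set: A] /\
        span2 (@tauB _ _ C) [set: mcY C] [set: mcX C] = [set: B] /\
        (forall t, span2 (@tauA _ _ C) (X_ t) (Y_ t^-1%g) = gr_dom A t) /\
        (forall t, span2 (@tauB _ _ C) (Y_ t) (X_ t^-1%g) = gr_dom B t)].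

End MoritaContexts.

(* Main.v *)
Require Import Defs.
From HB Require Import structures.
From mathcomp Require Import all_boot all_algebra.
From mathcomp Require Import all_classical.

(** Let [C] be the crossed product, with components [C_t = D_t delta_t]. As
    [w_(t,t^-1)] is invertible, [C_t C_(t^-1) = D_t delta_1]: the twist is
    invisible in these products. Hence [C_t C_(t^-1) C_t = C_t], and the ideals
    [C_t C_(t^-1)] of [C_1] commute ([crossed_symmetric],
    [crossed_dom_comm]). The rest of the argument uses only these two facts, for
    an arbitrary graded algebra [C].

    Let [B] be the algebra of finite [G x G] matrices over [C] whose entry at
    [(r, s)] lies in [C_(r^-1) C_s]. Translating both indices by [t] is a
    partial action on [B], between the ideals of the matrices with entries in
    [C_(r^-1) C_t C_(t^-1) C_s] ([shift_action]). Translations compose strictly,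
    so this action has no twist; the cocycle has been absorbed by the
    multiplication of the entries.

    Writing the entry of [b] at [(r, s)] in position [(r, t^-1 s)] turns
    [b delta_t] into a matrix again, and turns the skew group algebra [M] of
    this action into an algebra of finite matrices over [C], where an entry of
    degree [u] in position [(r, s)] has degree [r u s^-1]. Let [e] be the matrix
    unit at [(1, 1)], a multiplier of [M]. The corner [e M e] is a copy of [C],
    with the same grading ([base_entry_bij]), and [e] is full: every matrix unit
    factors through the index [1] ([base_vertex_full]). So [e M] and [M e], with
    the multiplication of [M] as pairings, form a Morita context between [C] and
    [M]. It is strong because [e] can be erased between two components of [M]
    ([corner_erase]), which reduces all its conditions to
    [M_t M_(t^-1) M_t = M_t] ([corner_equivalence]). *)

Set Implicit Arguments.
Unset Strict Implicit.
Unset Printing Implicit Defensive.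

Import GRing.Theory.
Local Open Scope classical_set_scope.
Local Open Scope ring_scope.
Local Open Scope nualg_scope.

(** * Linear images and products of sets *)

Section LinearOn.
Variable k : comPzRingType.

(** Relative to a subset because maps such as [tact T g] are total functions
    that are meaningful on an ideal only. *)
Definition linear_on (U V : lmodType k) (S : set U) (f : U -> V) : Prop :=
  forall (c : k) u v, S u -> S v -> f (c *: u + v) = c *: f u + f v.

Lemma linear_on0 (U V : lmodType k) (S : set U) (f : U -> V) :
  S 0 -> linear_on S f -> f 0 = 0.
Proof.
move=> S0 fP; have := fP (-1) 0 0 S0 S0.
by rewrite scaler0 addr0 scaleN1r addNr.
Qed.

Lemma linear_on_sum (U V : lmodType k) (S : set U) (f : U -> V) (I : Type)
    (r : seq I) (F : I -> U) :
  submodule S -> linear_on S f -> (forall i, S (F i)) ->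
  f (\sum_(i <- r) F i) = \sum_(i <- r) f (F i).
Proof.
move=> mS fP SF; elim: r => [|i r IH].
  by rewrite !big_nil (linear_on0 mS.1 fP).
rewrite !big_cons -[F i]scale1r fP ?scale1r ?IH //.
exact: submodule_sum.
Qed.

Lemma submoduleT (V : lmodType k) : submodule [set: V].
Proof. by []. Qed.

(** This carries equalities between products of sets along the embeddings
    of the sides of a Morita context, and along [delta]. The submodule [Q] only
    has to contain the generators, as [f] may fail to be linear elsewhere. *)
Lemma span2_image (U V W U' V' W' : lmodType k) (op : U -> V -> W)
    (op' : U' -> V' -> W') (f : W -> W') (g : U -> U') (h : V -> V')
    (Q : set W) (S : set U) (T : set V) :
  submodule Q -> linear_on Q f ->
  (forall u v, S u -> T v -> Q (op u v) /\ f (op u v) = op' (g u) (h v)) ->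
  f @` span2 op S T = span2 op' (g @` S) (h @` T).
Proof.
move=> mQ fP fM; apply/seteqP; split.
  move=> _ [w Sw <-].
  suff [] : Q w /\ span2 op' (g @` S) (h @` T) (f w) by [].
  move: w Sw; apply: span2_min => [|u v Su Tv].
    split=> [|c x y [Qx Sx] [Qy Sy]].
      split; first exact: mQ.1.
      by rewrite (linear_on0 mQ.1 fP); apply: (span_submodule _).1.
    split; first exact: mQ.2.
    by rewrite fP //; apply: (span_submodule _).2.
  have [Qw ->] := fM _ _ Su Tv; split=> //.
  by apply: mem_span2; [exists u | exists v].
move=> w Sw.
suff [z [Sz _] <-] : (f @` (span2 op S T `&` Q)) w by exists z.
move: w Sw; apply: span2_min => [|_ _ [u Su <-] [v Tv <-]].
  split.
    exists 0; last exact: (linear_on0 mQ.1 fP).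
    by split; [exact: (span_submodule _).1 | exact: mQ.1].
  move=> c _ _ [x [Sx Qx] <-] [y [Sy Qy] <-].
  exists (c *: x + y); last exact: fP.
  by split; [exact: (span_submodule _).2 | exact: mQ.2].
have [Qw fw] := fM _ _ Su Tv.
by exists (op u v) => //; split=> //; apply: mem_span2.
Qed.

End LinearOn.

Section SetProducts.
Variables (k : comPzRingType) (A : nuAlgType k).
Implicit Types (S T U : set A).

Lemma mulsS S S' T T' : S `<=` S' -> T `<=` T' -> S `** T `<=` S' `** T'.
Proof.
move=> SS' TT'; apply: span2_min => [|u v Su Tv]; first exact: span_submodule.
by apply: mem_span2; [apply: SS' | apply: TT'].
Qed.

Lemma mulsA S T U : S `** (T `** U) = S `** T `** U.
Proof.
apply/seteqP; split.
  apply: span2_min => [|x y Sx]; first exact: span_submodule.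
  move: y; apply: span2_min => [|y z Ty Uz].
    have [S0 SP] := span_submodule [set u ** v | u in S `** T & v in U].
    split=> [|c p q Sp Sq]; first by rewrite numulx0.
    by rewrite numulPr; apply: SP.
  by rewrite numulA; apply: mem_span2 => //; apply: mem_span2.
apply: span2_min => [|y z]; first exact: span_submodule.
move=> + Uz; move: y; apply: span2_min => [|x y Sx Ty].
  have [S0 SP] := span_submodule [set u ** v | u in S & v in T `** U].
  split=> [|c p q Sp Sq]; first by rewrite numul0x.
  by rewrite numulPl; apply: SP.
by rewrite -numulA; apply: mem_span2 => //; apply: mem_span2.
Qed.

End SetProducts.

(** * Submodules as modules *)

Section SubmoduleTypes.
Variables (k : comPzRingType) (V : lmodType k) (S : set V) (mS : submodule S).

Definition submod_pred (_ : submodule S) : {pred V} := fun v => `[< S v >].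

(** The proof [mS] is a parameter of the type because the module structure,
    which is inferred from the type, depends on it. *)
Record submod_of :=
  SubmodOf { submod_val :> V; _ : submod_val \in submod_pred mS }.

Fact submod_pred_closed : GRing.submod_closed (submod_pred mS).
Proof.
split; first by apply/asboolP; case: mS.
by move=> c u v /asboolP Su /asboolP Sv; apply/asboolP; apply: mS.2.
Qed.

HB.instance Definition _ := GRing.isSubmodClosed.Build k V (submod_pred mS)
  submod_pred_closed.
HB.instance Definition _ := [isSub for submod_val].
HB.instance Definition _ := [Choice of submod_of by <:].
HB.instance Definition _ := [SubChoice_isSubLmodule of submod_of by <:].

Lemma submodP (x : submod_of) : S (submod_val x).
Proof. by case: x => v /= /asboolP. Qed.

Lemma submod_inj (x y : submod_of) : submod_val x = submod_val y -> x = y.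
Proof. exact: val_inj. Qed.

Definition submod_in v (Sv : S v) : submod_of := SubmodOf (asboolT Sv).

Lemma submod_linear (c : k) (x y : submod_of) :
  submod_val (c *: x + y) = c *: submod_val x + submod_val y.
Proof. by rewrite -[submod_val _]/(val _) linearP. Qed.

End SubmoduleTypes.

(** * Symmetrically graded algebras *)

Section GradedAlgebraTheory.
Variables (k : comPzRingType) (G : groupType) (A : graded_algebra k G).

Lemma gr_submodule t : submodule (gr A t).
Proof. by have [mA _ _] := gr_direct A. Qed.

Lemma gr_mulS s t : gr A s `** gr A t `<=` gr A (s * t)%g.
Proof.
apply: span2_min; first exact: gr_submodule.
by move=> u v; apply: gr_mul.
Qed.

(** The graded form of the identity [t t^-1 t = t] of inverse semigroups: it
    makes [A_t] a unital bimodule over [A_t A_(t^-1)] and [A_(t^-1) A_t]. *)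
Definition symmetrically_graded : Prop :=
  forall t, gr A t `** gr A t^-1%g `** gr A t = gr A t.

Hypothesis symA : symmetrically_graded.

Lemma symmetric_idempotent : idempotent_alg A.
Proof.
apply/seteqP; split=> // x _.
have [_ /(_ x)[s [f [_ fA ->]]] _] := gr_direct A.
apply: submodule_sum => [|t _]; first exact: span_submodule.
by move: (fA t); rewrite -{1}symA; apply: mulsS.
Qed.

Lemma symmetric_dom_idem t : gr_dom A t `** gr_dom A t = gr_dom A t.
Proof. by rewrite /gr_dom mulsA symA. Qed.

End GradedAlgebraTheory.

(** * Full corners of a graded algebra *)

Section Corner.
Variables (k : comPzRingType) (G : groupType) (C M : graded_algebra k G).
Variable e : multiplier [set: M].

Notation eL := (mulL e).
Notation eR := (mulR e).

Definition corner : set M := [set m | eL m = m /\ eR m = m].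

Hypothesis eLL : forall m, eL (eL m) = eL m.
Hypothesis eRR : forall m, eR (eR m) = eR m.
Hypothesis eLR : forall m, eL (eR m) = eR (eL m).
Hypothesis eL_gr : forall t m, gr M t m -> gr M t (eL m).
Hypothesis eR_gr : forall t m, gr M t m -> gr M t (eR m).
Hypothesis symC : symmetrically_graded C.
Hypothesis symM : symmetrically_graded M.
(* M e M = M in every degree, with a second factor of degree 1. *)
Hypothesis e_full : forall t, gr M t `<=` gr M t `** (eL @` gr M 1%g).

Variable kappa : M -> C.
Hypothesis kappaP : linear_on [set: M] kappa.
Hypothesis kappaM : forall s t m n, gr M s m -> gr M t n ->
  corner m -> corner n -> kappa (m ** n) = kappa m ** kappa n.
Hypothesis kappa_bij : forall t, set_bij (corner `&` gr M t) (gr C t) kappa.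

Let eLP : linear_on [set: M] eL. Proof. by move=> *; apply: mulLP. Qed.
Let eRP : linear_on [set: M] eR. Proof. by move=> *; apply: mulRP. Qed.

Let corner_sub : submodule corner.
Proof.
split; first by split; [rewrite (linear_on0 _ eLP) | rewrite (linear_on0 _ eRP)].
by move=> c u v [Lu Ru] [Lv Rv]; split; rewrite ?eLP ?eRP ?Lu ?Lv ?Ru ?Rv.
Qed.

Let corner_e m : corner (eL (eR m)).
Proof. by split; [rewrite eLL | rewrite -eLR eRR]. Qed.

Let eL_image S T : eL @` (S `** T) = (eL @` S) `** T.
Proof.
rewrite (span2_image (op' := numul) (g := eL) (h := id) (submoduleT _) eLP).
  by rewrite image_id.
by move=> u v _ _; split; rewrite ?mulLM.
Qed.

Let eR_image S T : eR @` (S `** T) = S `** (eR @` T).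
Proof.
rewrite (span2_image (op' := numul) (g := id) (h := eR) (submoduleT _) eRP).
  by rewrite image_id.
by move=> u v _ _; split; rewrite ?mulRM.
Qed.

Let e_mid S T : (eR @` S) `** T = S `** (eL @` T).
Proof.
apply/seteqP; split; apply: span2_min; try exact: span_submodule.
  move=> _ v [u Su <-] Tv; rewrite mulRL //.
  by apply: mem_span2 => //; exists v.
move=> u _ Su [v Tv <-]; rewrite -mulRL //.
by apply: mem_span2 => //; exists u.
Qed.

Let eL_idem (S : set M) : eL @` (eL @` S) = eL @` S.
Proof.
apply/seteqP; split; first by move=> _ [_ [m Sm <-] <-]; rewrite eLL; exists m.
by move=> _ [m Sm <-]; exists (eL m); rewrite ?eLL //; exists m.
Qed.

Let eL_sub t : eL @` gr M t `<=` gr M t.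
Proof. by move=> _ [m Mm <-]; apply: eL_gr. Qed.

Let eM t : set M := eL @` gr M t.
Let Me t : set M := eR @` gr M t.
Let eMe t : set M := eL @` (eR @` gr M t).

(** By fullness [M_s = M_s e M_1], and [M_1 M_t] is contained in [M_t]; so
    [e] can be erased, or inserted, between two homogeneous components. *)
Lemma corner_erase s t : gr M s `** eM t = gr M s `** gr M t.
Proof.
apply/seteqP; split; first by apply: mulsS => //; apply: eL_sub.
apply: subset_trans (mulsS (e_full (t := s)) (@subset_refl _ _)) _.
rewrite -mulsA -eL_image; apply: mulsS => // _ [m Mm <-].
by exists m => //; rewrite -[t](mul1g t); apply: gr_mulS.
Qed.

Let eMeE t : eMe t = corner `&` gr M t.
Proof.
apply/seteqP; split.
  move=> _ [_ [m Mm <-] <-]; split; first exact: corner_e.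
  exact/eL_gr/eR_gr.
by move=> m [[Lm Rm] Mm]; exists m => //; exists m.
Qed.

(* As e preserves degrees, the corner is the direct sum of its components;
   so kappa, bijective in each degree, is bijective on the whole corner. *)
Let corner_decomp m : corner m -> exists (s : seq G) (f : G -> M),
  [/\ uniq s, forall t, corner (f t) /\ gr M t (f t) & m = \sum_(t <- s) f t].
Proof.
have [_ /(_ m)[s [f [us fM ->]]] _] := gr_direct M.
move=> [Lm Rm]; exists s, (fun t => eL (eR (f t))); split=> //.
  by move=> t; split; [apply: corner_e | apply/eL_gr/eR_gr].
rewrite -[LHS]Lm -Rm !(linear_on_sum _ (submoduleT M) eRP) //.
by rewrite (linear_on_sum _ (submoduleT M) eLP).
Qed.

Let kappa0 m : corner m -> kappa m = 0 -> m = 0.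
Proof.
move=> /corner_decomp[s [f [us fM ->]]].
rewrite (linear_on_sum _ (submoduleT M) kappaP) // => k0.
have [_ _ /(_ s (fun t => kappa (f t)) us _ k0) kf0] := gr_direct C.
rewrite big_seq big1 // => t ts.
have [_ + _] := kappa_bij t.
apply; rewrite ?inE //.
  by split=> //; [exact: corner_sub.1 | exact: (gr_submodule M t).1].
rewrite kf0 ?(linear_on0 _ kappaP) // => u.
by have [+ _ _] := kappa_bij u; apply.
Qed.

Let kappa_inj m n : corner m -> corner n -> kappa m = kappa n -> m = n.
Proof.
move=> cm cn kmn; apply/eqP; rewrite -subr_eq0; apply/eqP.
rewrite addrC -scaleN1r; apply: kappa0; first exact: corner_sub.2.
by rewrite kappaP // kmn scaleN1r addNr.
Qed.

Let kappa_surj c : exists m, corner m /\ kappa m = c.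
Proof.
have [_ /(_ c)[s [f [us fC ->]]] _] := gr_direct C.
have /choice[g gP] : forall t, exists m, corner m /\ kappa m = f t.
  move=> t; have [_ _ /(_ _ (fC t))[m [cm _] <-]] := kappa_bij t.
  by exists m.
exists (\sum_(t <- s) g t); split.
  by apply: submodule_sum => // t _; case: (gP t).
rewrite (linear_on_sum _ (submoduleT M) kappaP) //.
by apply: eq_bigr => t _; case: (gP t).
Qed.

Let iota (c : C) : M := projT1 (cid (kappa_surj c)).

Let iota_corner c : corner (iota c).
Proof. by rewrite /iota; case: cid => m []. Qed.

Let iotaK c : kappa (iota c) = c.
Proof. by rewrite /iota; case: cid => m []. Qed.

Let kappaK m : corner m -> iota (kappa m) = m.
Proof. by move=> cm; apply: kappa_inj; rewrite ?iotaK. Qed.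

Let iotaP : linear_on [set: C] iota.
Proof.
move=> c u v _ _; apply: kappa_inj => //; first exact: corner_sub.2.
by rewrite kappaP // !iotaK.
Qed.

Let cornerM m n : corner m -> corner n -> corner (m ** n).
Proof. by move=> [Lm Rm] [Ln Rn]; split; rewrite ?mulLM ?mulRM ?Lm ?Rn. Qed.

Let kappaMM m n : corner m -> corner n -> kappa (m ** n) = kappa m ** kappa n.
Proof.
move=> /corner_decomp[s [f [_ fM ->]]] /corner_decomp[u [g [_ gM ->]]].
rewrite !(linear_on_sum _ (submoduleT M) kappaP) // !numul_suml.
rewrite (linear_on_sum _ (submoduleT M) kappaP) //; apply: eq_bigr => i _.
rewrite !numul_sumr (linear_on_sum _ (submoduleT M) kappaP) //.
by apply: eq_bigr => j _; apply: kappaM (fM i).2 (gM j).2 (fM i).1 (gM j).1.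
Qed.

Let iotaM c d : iota (c ** d) = iota c ** iota d.
Proof.
by apply: kappa_inj => //; [apply: cornerM | rewrite kappaMM // !iotaK].
Qed.

Let iota_image t : iota @` gr C t = eMe t.
Proof.
have [kC _ kS] := kappa_bij t; rewrite eMeE; apply/seteqP; split.
  by move=> _ [c /kS[m [cm Mm] <-] <-]; rewrite kappaK.
move=> m [cm Mm]; exists (kappa m); last exact: kappaK.
by apply: kC; split.
Qed.

Let iota_mul S T : iota @` (S `** T) = (iota @` S) `** (iota @` T).
Proof. exact: span2_image (submoduleT _) iotaP _. Qed.

Let iota_inj : injective iota.
Proof. by move=> c d /(congr1 kappa); rewrite !iotaK. Qed.

Let image_inj (U V : Type) (f : U -> V) (S T : set U) :
  injective f -> f @` S = f @` T -> S = T.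
Proof.
move=> finj fST; apply/seteqP; split=> x Sx.
  have : (f @` T) (f x) by rewrite -fST; exists x.
  by move=> [y Ty /finj <-].
have : (f @` S) (f x) by rewrite fST; exists x.
by move=> [y Ty /finj <-].
Qed.

Let left_part : set M := [set m | eL m = m].
Let right_part : set M := [set m | eR m = m].

Let left_sub : submodule left_part.
Proof.
split; first by rewrite /left_part /= (linear_on0 _ eLP).
by move=> c u v Lu Lv; rewrite /left_part /= eLP // Lu Lv.
Qed.

Let right_sub : submodule right_part.
Proof.
split; first by rewrite /right_part /= (linear_on0 _ eRP).
by move=> c u v Lu Lv; rewrite /right_part /= eRP // Lu Lv.
Qed.

Local Notation X := (submod_of left_sub).
Local Notation Y := (submod_of right_sub).

Let leftM m n : left_part m -> left_part (m ** n).
Proof. by rewrite /left_part /= mulLM // => ->. Qed.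

Let rightM m n : right_part n -> right_part (m ** n).
Proof. by rewrite /right_part /= mulRM // => ->. Qed.

Let lactX (c : C) (x : X) : X := submod_in left_sub (leftM (submod_val x) (iota_corner c).1).
Let ractX (x : X) (m : M) : X := submod_in left_sub (leftM m (submodP x)).
Let lactY (m : M) (y : Y) : Y := submod_in right_sub (rightM m (submodP y)).
Let ractY (y : Y) (c : C) : Y := submod_in right_sub (rightM (submod_val y) (iota_corner c).2).

Let bimodX : bimodule C M.
Proof.
exists X lactX ractX; move=> *; apply: submod_inj => /=;
  rewrite ?submod_linear /= ?iotaP ?iotaM ?numulPl ?numulPr ?numulA //.
Defined.

Let bimodY : bimodule M C.
Proof.
exists Y lactY ractY; move=> *; apply: submod_inj => /=;
  rewrite ?submod_linear /= ?iotaP ?iotaM ?numulPl ?numulPr ?numulA //.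
Defined.

Let tauC (x : bimodX) (y : bimodY) : C := kappa (submod_val x ** submod_val y).
Let tauM (y : bimodY) (x : bimodX) : M := submod_val y ** submod_val x.

Let XY_corner (x : X) (y : Y) : corner (submod_val x ** submod_val y).
Proof.
by split; [exact: leftM (submodP x) | exact: rightM (submodP y)].
Qed.

Let XP c (x x' : bimodX) :
  submod_val (c *: x + x') = c *: submod_val x + submod_val x'.
Proof. exact: submod_linear. Qed.

Let YP c (y y' : bimodY) :
  submod_val (c *: y + y') = c *: submod_val y + submod_val y'.
Proof. exact: submod_linear. Qed.

Let tauC_map : balanced_bimodule_map tauC.
Proof.
split; [|split; [|split; [|split]]]; rewrite /tauC.
- by move=> c x x' y; rewrite XP numulPl kappaP.
- by move=> c x y y'; rewrite YP numulPr kappaP.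
- by move=> x b y /=; rewrite numulA.
- by move=> a x y /=; rewrite -numulA kappaMM // iotaK.
- by move=> x y a /=; rewrite numulA kappaMM // iotaK.
Qed.

Let tauM_map : balanced_bimodule_map tauM.
Proof.
split; [|split; [|split; [|split]]]; rewrite /tauM.
- by move=> c x x' y; rewrite YP numulPl.
- by move=> c x y y'; rewrite XP numulPr.
- by move=> x b y /=; rewrite numulA.
- by move=> a x y /=; rewrite -numulA.
- by move=> x y a /=; rewrite numulA.
Qed.

Let context : morita_context C M.
Proof.
exists bimodX bimodY tauC tauM; first exact: tauC_map.
- exact: tauM_map.
- move=> x y x'; apply: submod_inj; rewrite /= /tauC kappaK //.
  by rewrite /tauM numulA.
- by move=> y x y'; apply: submod_inj; rewrite /= /tauC kappaK // /tauM numulA.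
Defined.

Let X_ t : set X := [set x | gr M t (submod_val x)].
Let Y_ t : set Y := [set y | gr M t (submod_val y)].

Let val_lin (S : set M) (mS : submodule S) :
  linear_on [set: submod_of mS] (@submod_val _ _ _ mS).
Proof. by move=> c u v _ _; apply: submod_linear. Qed.

Let X_image t : (@submod_val _ _ _ left_sub) @` X_ t = eM t.
Proof.
apply/seteqP; split; first by move=> _ [x Xx <-]; exists (submod_val x); last exact: (submodP x).
move=> _ [m Mm <-]; exists (submod_in left_sub (eLL m)) => //.
exact: eL_gr.
Qed.

Let Y_image t : (@submod_val _ _ _ right_sub) @` Y_ t = Me t.
Proof.
apply/seteqP; split; first by move=> _ [x Xx <-]; exists (submod_val x); last exact: (submodP x).
move=> _ [m Mm <-]; exists (submod_in right_sub (eRR m)) => //.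
exact: eR_gr.
Qed.

(* The fixed points of a homogeneous projector are graded: the projector maps a
   decomposition of a fixed point to one into fixed points. *)
Let direct_part (p : M -> M) (S : set M) (mS : submodule S) :
  linear_on [set: M] p -> (forall m, S (p m)) -> (forall m, S m -> p m = m) ->
  (forall t m, gr M t m -> gr M t (p m)) ->
  direct_sum (fun t => [set x : submod_of mS | gr M t (submod_val x)]).
Proof.
move=> pP pS pE pM; have [_ decM indM] := gr_direct M; split=> [t|x|s f us fS f0 t ts].
- have [M0 MP] := gr_submodule M t; split=> //.
  by move=> c u v Mu Mv; have := MP c _ _ Mu Mv; rewrite -submod_linear.
- have [s [f [us fM xE]]] := decM (submod_val x).
  exists s, (fun t => submod_in mS (pS (f t))); split=> //.
    by move=> t; apply: pM.
  apply: submod_inj; rewrite (linear_on_sum _ (submoduleT _) (val_lin (mS := mS))) //.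
  rewrite -[LHS]pE; last exact: submodP.
  by rewrite xE (linear_on_sum _ (submoduleT _) pP).
- apply: submod_inj.
  apply: (indM s (fun t => submod_val (f t)) us fS _ t ts).
  by rewrite -(linear_on_sum _ (submoduleT _) (val_lin (mS := mS))) // f0.
Qed.

Let iota_gr t c : gr C t c -> gr M t (iota c).
Proof.
move=> Cc; have : eMe t (iota c) by rewrite -iota_image; exists c.
by rewrite eMeE => -[].
Qed.

Let kappa_gr t m : corner m -> gr M t m -> gr C t (kappa m).
Proof. by move=> cm Mm; have [+ _ _] := kappa_bij t; apply. Qed.

Let graded : @graded_morita_context k G C M context X_ Y_.
Proof.
split.
- split; first exact: (direct_part (p := eL)).
    by move=> s t a x Ca Xx; apply: gr_mul => //; apply: iota_gr.
  by move=> s t x b Xx Mb; apply: gr_mul.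
- split; first exact: (direct_part (p := eR)).
    by move=> s t x b Xx Mb; apply: gr_mul.
  by move=> s t a x Ca Xx; apply: gr_mul => //; apply: iota_gr.
- by move=> r s x y Xx Yy; apply: kappa_gr => //; apply: gr_mul.
- by move=> r s x y Xx Yy; apply: gr_mul.
Qed.

Let iota_dom t : iota @` gr_dom C t = eMe t `** eMe t^-1%g.
Proof. by rewrite iota_mul !iota_image. Qed.

Let eMeRL t : eMe t = eR @` eM t.
Proof.
apply/seteqP; split=> _ [_ [m Mm <-] <-].
  by rewrite eLR; exists (eL m) => //; exists m.
by rewrite -eLR; exists (eR m) => //; exists m.
Qed.

Let dom_eMe s t : eMe s `** eMe t = eR @` (eL @` (gr M s `** gr M t)).
Proof.
by rewrite (eMeRL s) e_mid eL_idem -/(eMe t) eMeRL -eR_image -eL_image corner_erase.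
Qed.

Let symM' t : gr M t `** (gr M t^-1%g `** gr M t) = gr M t.
Proof. by rewrite mulsA symM. Qed.

Let val_X := @submod_val _ _ _ left_sub.
Let val_Y := @submod_val _ _ _ right_sub.

Let val_X_lin : linear_on [set: X] val_X. Proof. exact: val_lin. Qed.
Let val_Y_lin : linear_on [set: Y] val_Y. Proof. exact: val_lin. Qed.

Let strong : @strong_context k G C M context X_ Y_.
Proof.
move=> t; split; split.
- apply: (image_inj (f := val_X)); first exact: submod_inj.
  rewrite (span2_image (op' := numul) (g := iota) (h := val_X)
    (submoduleT _) val_X_lin) // iota_dom dom_eMe X_image.
  by rewrite e_mid eL_idem -eL_image -mulsA corner_erase symM'.
- apply: (image_inj (f := val_X)); first exact: submod_inj.
  rewrite (span2_image (op' := numul) (g := val_X) (h := id)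
    (submoduleT _) val_X_lin) // image_id X_image.
  by rewrite /gr_dom invgK -eL_image symM'.
- apply: (image_inj (f := val_Y)); first exact: submod_inj.
  rewrite (span2_image (op' := numul) (g := id) (h := val_Y)
    (submoduleT _) val_Y_lin) // image_id Y_image.
  by rewrite /gr_dom -eR_image symM.
- apply: (image_inj (f := val_Y)); first exact: submod_inj.
  rewrite (span2_image (op' := numul) (g := val_Y) (h := iota)
    (submoduleT _) val_Y_lin) // iota_dom invgK dom_eMe Y_image.
  by rewrite -eR_image e_mid eL_idem eL_image mulsA corner_erase symM.
Qed.

Let tauC_full : span2 tauC [set: X] [set: Y] = [set: C].
Proof.
apply/seteqP; split=> // c _.
have : ([set: C] `** [set: C]) c by rewrite (symmetric_idempotent symC).
move: c; apply: span2_min => [|c d _ _]; first exact: span_submodule.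
have -> : c ** d = tauC (submod_in left_sub (iota_corner c).1)
                        (submod_in right_sub (iota_corner d).2).
  by rewrite /tauC /= kappaMM ?iotaK.
exact: mem_span2.
Qed.

Let tauM_full : span2 tauM [set: Y] [set: X] = [set: M].
Proof.
apply/seteqP; split=> // m _.
have [_ /(_ m)[s [f [_ fM ->]]] _] := gr_direct M.
apply: submodule_sum => [|t _]; first exact: span_submodule.
move: (f t) (e_full (fM t)).
apply: span2_min => [|u _ _ [v _ <-]]; first exact: span_submodule.
have -> : u ** eL v =
    tauM (submod_in right_sub (eRR u)) (submod_in left_sub (eLL v)).
  by rewrite /tauM /= mulRL // eLL.
exact: mem_span2.
Qed.

Let tauC_dom t : span2 tauC (X_ t) (Y_ t^-1%g) = gr_dom C t.
Proof.
apply: (image_inj iota_inj); rewrite iota_dom dom_eMe.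
rewrite (span2_image (op' := numul) (g := val_X) (h := val_Y)
    (submoduleT _) iotaP); last by move=> x y _ _; split; rewrite // /tauC kappaK.
by rewrite X_image Y_image -eR_image -eL_image.
Qed.

Let tauM_dom t : span2 tauM (Y_ t) (X_ t^-1%g) = gr_dom M t.
Proof.
rewrite -[LHS]image_id (span2_image (op' := numul) (g := val_Y) (h := val_X)
    (submoduleT M)) //.
by rewrite X_image Y_image e_mid eL_idem corner_erase.
Qed.

(** The standard context of a full idempotent: [e M], [M e] and the
    multiplication of [M], where [kappa] identifies [e M e] with [C]. *)
Theorem corner_equivalence : strongly_graded_equivalent C M.
Proof.
split; first exact: symmetric_idempotent.
- exact: symmetric_idempotent.
- by move=> t; split; apply: symmetric_dom_idem.
exists context, X_, Y_; split; first exact: graded.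
split; first exact: strong.
split; first exact: tauC_full.
split; first exact: tauM_full.
by split; [exact: tauC_dom | exact: tauM_dom].
Qed.

End Corner.

(** * Crossed products are symmetrically graded *)

Section CrossedProductIsSymmetric.
Variables (k : comPzRingType) (G : groupType) (A : nuAlgType k).
Variable T : twisted_partial_action G A.

Notation C := (crossed_product T).
Notation D := (tdom T).
Notation al := (tact T).

Let mD g : submodule (D g). Proof. by case: (tdom_ideal T g). Qed.
Let DMl g a x : D g x -> D g (a ** x).
Proof. by case: (tdom_ideal T g) => _ H /(H a) []. Qed.
Let D1 a : D 1%g a. Proof. by rewrite tdom1. Qed.
Let al_in g x : D g^-1%g x -> D g (al g x).
Proof. by case: (tact_iso T g) => -[+ _ _] _ _ => /[apply]. Qed.
Let alP g : linear_on (D g^-1%g) (al g).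
Proof. by case: (tact_iso T g) => _ + _ c u v => /[apply]/[apply]. Qed.

Lemma delta_gr g a : D g a -> gr C g (delta T g a).
Proof. by move=> Da h /negPf hg; rewrite deltaE // hg. Qed.

Lemma gr_delta g (x : C) : gr C g x -> x = delta T g (x g).
Proof.
move=> xg; apply: crossedP => h; rewrite deltaE; last exact: crossed_in.
by case: eqP => [->|/eqP /xg].
Qed.

Lemma delta_linear g : linear_on (D g) (delta T g).
Proof.
move=> c u v Du Dv; apply: crossedP => h.
rewrite crossed_PE !deltaE //; last exact: (mD g).2.
by case: eqP => // _; rewrite scaler0 addr0.
Qed.

Lemma delta_mulE g h a b : D g a -> D h b ->
  (delta T g a : C) ** delta T h b = delta T (g * h)%g (crossed_coef T g h a b).
Proof. exact: delta_mul. Qed.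

Lemma delta1_mul g a b : D g b ->
  delta T 1%g a ** delta T g b = delta T g (a ** b).
Proof.
move=> Db; rewrite [LHS]delta_mulE // /crossed_coef.
have -> : tactV T 1%g a = a.
  by rewrite -{1}(tact1 T a) tactK // invg1.
rewrite tact1; have Dab : (D 1%g `** D (1 * g)%g) (a ** b).
  by rewrite mul1g; apply: mem_span2.
by have [_ ->] := twist1g Dab; rewrite /= mul1g.
Qed.

(** The multiplier [w_(g,g^-1)] of [D_g] is invertible, so it maps [D_g] onto
    itself and leaves no trace in the span of the products. *)
Lemma crossed_dom g : gr_dom C g = delta T 1%g @` D g.
Proof.
have w_in x : D g^-1%g x ->
    (D g `** D (g * g^-1)%g) (al g x).
  move=> Dx; rewrite -tact_dom; exists x => //.
  by rewrite tdom_idem.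
apply/seteqP; split.
  apply: span2_min.
    split.
      exists 0; first exact: (mD _).1.
      by rewrite (linear_on0 _ (@delta_linear 1%g)) //; apply: (mD _).1.
    move=> c _ _ [a Da <-] [b Db <-]; exists (c *: a + b); first exact: (mD g).2.
    exact: delta_linear.
  move=> x y xg yg; rewrite (gr_delta xg) (gr_delta yg).
  have := crossed_in x g; have := crossed_in y g^-1%g.
  move: (x g) (y g^-1%g) => a b Db Da.
  rewrite [_ ** _]delta_mulE // mulgV.
  exists (crossed_coef T g g^-1%g a b) => //.
  have := mulR_in (twist T g g^-1%g) (w_in _ (DMl _ Db)).
  by move/(_ (tactV T g a)); apply: ideal_mulSl; apply: tdom_ideal.
move=> _ [d Dd <-].
(* d = (d w^-1) w, and d w^-1 is alpha_g(z) for some z in D_(g^-1), which is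
   a sum of products. *)
have [v [_ vw]] := twist_inv T g g^-1%g.
have {}Dd : (D g `** D (g * g^-1)%g) d.
  by rewrite -(tactVK Dd); apply/w_in/tactV_in.
have [_ /= <-] := vw d Dd.
have Dvd : D g (mulR v d).
  by apply: ideal_mulSl (mulR_in v Dd); apply: tdom_ideal.
rewrite -(tactVK Dvd); move: (tactV T g _) (tactV_in Dvd) => z.
rewrite -{1}tdom_idem => Dz.
have iC := span_submodule [set x ** y | x in gr C g & y in gr C g^-1%g].
suff [] : D g^-1%g z /\
  gr_dom C g (delta T 1%g (mulR (twist T g g^-1%g) (al g z))) by [].
have wP c p q : D g^-1%g p -> D g^-1%g q ->
    mulR (twist T g g^-1%g) (al g (c *: p + q)) =
    c *: mulR (twist T g g^-1%g) (al g p) + mulR (twist T g g^-1%g) (al g q).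
  by move=> Dp Dq; rewrite alP // mulRP //; apply: w_in.
move: z Dz; apply: span2_min => [|p q Dp Dq].
  split=> [|c p q [Dp gp] [Dq gq]].
    have D0 := (mD g^-1%g).1; split=> //.
    have -> : mulR (twist T g g^-1%g) (al g 0) = 0.
      apply: (linear_on0 (S := D g^-1%g) (f := mulR (twist T g g^-1%g) \o al g)) => //.
    by rewrite (linear_on0 _ (@delta_linear 1%g)) //; apply: iC.1.
  split; first exact: (mD _).2.
  by rewrite wP // delta_linear //; apply: iC.2.
split; first exact: DMl.
have -> : mulR (twist T g g^-1%g) (al g (p ** q)) =
    crossed_coef T g g^-1%g (al g p) q.
  by rewrite /crossed_coef tactK.
rewrite -[X in delta T X](mulgV g) -delta_mulE //; last exact: al_in.
by apply: mem_span2; apply: delta_gr => //; apply: al_in.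
Qed.

Lemma delta1_image (S S' : set A) :
  (delta T 1%g @` S) `** (delta T 1%g @` S') = delta T 1%g @` (S `** S').
Proof.
by rewrite (span2_image (op' := (numul : C -> C -> C)) (g := delta T 1%g)
  (h := delta T 1%g) (mD 1%g) (@delta_linear 1%g)) // => u v _ _;
  rewrite delta1_mul.
Qed.

Lemma crossed_dom_comm s t :
  gr_dom C s `** gr_dom C t = gr_dom C t `** gr_dom C s.
Proof. by rewrite !crossed_dom !delta1_image tdomC. Qed.

Theorem crossed_symmetric : symmetrically_graded C.
Proof.
move=> t; apply/seteqP; split.
  apply: subset_trans (mulsS (@gr_mulS _ _ C t t^-1%g) (@subset_refl _ _)) _.
  by apply: subset_trans (@gr_mulS _ _ C _ _) _; rewrite mulgV mul1g.
move=> x xt; rewrite -/(gr_dom C t) crossed_dom (gr_delta xt).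
have := crossed_in x t; rewrite -{1}tdom_idem; move: (x t) => d Dd.
suff [] : D t d /\ ((delta T 1%g @` D t) `** gr C t) (delta T t d) by [].
have [S0 SP] := span_submodule
  [set x ** y | x in delta T 1%g @` D t & y in gr C t].
move: d Dd; apply: span2_min => [|p q Dp Dq].
  split=> [|c p q [Dp gp] [Dq gq]].
    split; first exact: (mD t).1.
    by rewrite (linear_on0 (mD t).1 (@delta_linear t)).
  split; first exact: (mD _).2.
  by rewrite delta_linear //; apply: SP.
split; first exact: DMl.
rewrite -delta1_mul //; apply: mem_span2; [by exists p | exact: delta_gr].
Qed.

End CrossedProductIsSymmetric.

(** * The algebra of matrices and its translation action *)

Section Matrices.
Variables (k : comPzRingType) (G : groupType) (C : graded_algebra k G).
Implicit Types (r s t q : G) (f : G -> G -> C) (E F : set C).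

Notation C_ := (gr C).
Notation D_ := (gr_dom C).

Definition supported (S : seq G) f : Prop :=
  forall r s, ~~ ((r \in S) && (s \in S)) -> f r s = 0.

Definition matrix_set : set (G -> G -> C) :=
  [set f | (exists S : seq G, supported S f) /\
           forall r s, (C_ r^-1%g `** C_ s) (f r s)].

Fact matrix_submodule : submodule matrix_set.
Proof.
split; first by split=> [|r s]; [exists [::] | apply: (span_submodule _).1].
move=> c u v [[S uS] uC] [[S' vS] vC]; split; last first.
  by move=> r s; exact: ((span_submodule _).2 c _ _ (uC r s) (vC r s)).
exists (S ++ S') => r s; rewrite !mem_cat => rs.
change (c *: u r s + v r s = 0); rewrite uS ?vS ?scaler0 ?addr0 //.
  by apply: contra rs => /andP[-> ->]; rewrite !orbT.
by apply: contra rs => /andP[-> ->].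
Qed.

Definition fmatrix := submod_of matrix_submodule.
HB.instance Definition _ := GRing.Lmodule.on fmatrix.

Implicit Types (a b : fmatrix).

Definition entry a r s : C := submod_val a r s.

Lemma fmatrixP a b : (forall r s, entry a r s = entry b r s) -> a = b.
Proof. by move=> ab; apply: submod_inj; apply/funext => r; apply/funext => s. Qed.

Lemma entry_in a r s : (C_ r^-1%g `** C_ s) (entry a r s).
Proof. by have [_] := submodP a. Qed.

Lemma entry_linear (c : k) a b r s :
  entry (c *: a + b) r s = c *: entry a r s + entry b r s.
Proof. by rewrite /entry [submod_val _]submod_linear. Qed.

Lemma entry0 r s : entry 0 r s = 0.
Proof. by []. Qed.

Lemma entry_sum (I : Type) (S : seq I) (x : I -> fmatrix) r s :
  entry (\sum_(i <- S) x i) r s = \sum_(i <- S) entry (x i) r s.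
Proof.
have lin : linear_on [set: fmatrix] (fun a => entry a r s).
  by move=> c u v _ _; apply: entry_linear.
by rewrite (linear_on_sum _ (submoduleT _) lin).
Qed.

Lemma entry_supp a : exists2 S : seq G, uniq S & supported S (entry a).
Proof.
have [[S aS] _] := submodP a; exists (undup S); first exact: undup_uniq.
by move=> r s; rewrite !mem_undup; apply: aS.
Qed.

Lemma entry_supp2 a b :
  exists2 S : seq G, uniq S & supported S (entry a) /\ supported S (entry b).
Proof.
have [S _ aS] := entry_supp a; have [S' _ bS] := entry_supp b.
exists (undup (S ++ S')); first exact: undup_uniq.
split=> r s; rewrite !mem_undup !mem_cat => rs.
  by apply: aS; apply: contra rs => /andP[-> ->].
by apply: bS; apply: contra rs => /andP[-> ->]; rewrite !orbT.
Qed.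

(** Total in [f], with the junk value [0] outside [matrix_set], so that [emat]
    and [shift] can be functions on whole types. *)
Definition mkmat f : fmatrix :=
  if pselect (matrix_set f) is left fM then submod_in matrix_submodule fM else 0.

Lemma mkmatE f r s : matrix_set f -> entry (mkmat f) r s = f r s.
Proof. by rewrite /mkmat => fM; case: pselect. Qed.

Definition fmatrix_mul_fun a b r s : C :=
  \sum_(q \in [set: G]) entry a r q ** entry b q s.

Lemma fmatrix_mul_funE S a b r s : uniq S ->
  (forall q, q \notin S -> entry a r q = 0) ->
  fmatrix_mul_fun a b r s = \sum_(q <- S) entry a r q ** entry b q s.
Proof.
move=> uS aS; rewrite /fmatrix_mul_fun (fsbigE S) //.
  by apply: eq_bigl => q; rewrite in_setT.
by move=> q _ /aS ->; rewrite numul0x.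
Qed.

Lemma gr_mulKS r q s :
  (C_ r^-1%g `** C_ q) `** (C_ q^-1%g `** C_ s) `<=` C_ r^-1%g `** C_ s.
Proof.
rewrite mulsA; apply: mulsS => //; rewrite -mulsA.
apply: subset_trans (mulsS (@subset_refl _ _) (@gr_mulS _ _ C q q^-1%g)) _.
by rewrite mulgV -[X in _ `<=` C_ X]mulg1; apply: gr_mulS.
Qed.

Fact fmatrix_mul_in a b : matrix_set (fmatrix_mul_fun a b).
Proof.
have [S uS [aS bS]] := entry_supp2 a b.
have E r s : fmatrix_mul_fun a b r s = \sum_(q <- S) entry a r q ** entry b q s.
  by apply: fmatrix_mul_funE => // q qS; apply: aS; rewrite (negPf qS) andbF.
split; last first.
  move=> r s; rewrite E; apply: submodule_sum => [|q _]; first exact: span_submodule.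
  by apply: (@gr_mulKS r q); apply: mem_span2; apply: entry_in.
exists S => r s; rewrite negb_and E => rs; apply: big1 => q _.
case/orP: rs => [rS|sS]; first by rewrite aS ?(negPf rS) // numul0x.
by rewrite bS ?(negPf sS) ?andbF // numulx0.
Qed.

Definition fmatrix_mul a b : fmatrix := submod_in matrix_submodule (fmatrix_mul_in a b).

Lemma fmatrix_mulE S a b r s : uniq S ->
  (forall q, q \notin S -> entry a r q = 0) ->
  entry (fmatrix_mul a b) r s = \sum_(q <- S) entry a r q ** entry b q s.
Proof. exact: fmatrix_mul_funE. Qed.

Lemma supported_row S a r q : supported S (entry a) -> q \notin S -> entry a r q = 0.
Proof. by move=> aS qS; rewrite aS // (negPf qS) andbF. Qed.

Fact fmatrix_mulA : associative fmatrix_mul.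
Proof.
move=> a b c; apply: fmatrixP => r s.
have [S uS [aS bS]] := entry_supp2 a b.
rewrite (fmatrix_mulE _ _ uS); last by move=> q; apply: supported_row.
have abS q : q \notin S -> entry (fmatrix_mul a b) r q = 0.
  move=> qS; rewrite (fmatrix_mulE _ _ uS); last by move=> ?; apply: supported_row.
  by rewrite big1 // => i _; rewrite (supported_row _ bS) // numulx0.
rewrite (fmatrix_mulE _ _ uS) //.
transitivity (\sum_(q <- S) \sum_(p <- S) entry a r q ** (entry b q p ** entry c p s)).
  apply: eq_bigr => q _; rewrite (fmatrix_mulE _ _ uS) ?numul_sumr //.
  by move=> p; apply: supported_row.
rewrite exchange_big; apply: eq_bigr => p _.
rewrite (fmatrix_mulE _ _ uS); last by move=> ?; apply: supported_row.
by rewrite numul_suml; apply: eq_bigr => q _; rewrite numulA.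
Qed.

Fact fmatrix_mulPl (c : k) a b x :
  fmatrix_mul (c *: a + b) x = c *: fmatrix_mul a x + fmatrix_mul b x.
Proof.
apply: fmatrixP => r s; have [S uS [aS bS]] := entry_supp2 a b.
rewrite entry_linear !(@fmatrix_mulE S) //; do ?by move=> q; apply: supported_row.
  rewrite scaler_sumr -big_split; apply: eq_bigr => q _.
  by rewrite entry_linear numulPl.
move=> q qS; rewrite entry_linear (supported_row _ aS) // (supported_row _ bS) //.
by rewrite scaler0 addr0.
Qed.

Fact fmatrix_mulPr (c : k) x a b :
  fmatrix_mul x (c *: a + b) = c *: fmatrix_mul x a + fmatrix_mul x b.
Proof.
apply: fmatrixP => r s; have [S uS xS] := entry_supp x.
rewrite entry_linear !(@fmatrix_mulE S) //; do ?by move=> q; apply: supported_row.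
rewrite scaler_sumr -big_split; apply: eq_bigr => q _.
by rewrite entry_linear numulPr.
Qed.

HB.instance Definition _ := Lmodule_isNUAlgebra.Build k fmatrix
  fmatrix_mulA fmatrix_mulPl fmatrix_mulPr.

Lemma entryM S a b r s : uniq S ->
  (forall q, q \notin S -> entry a r q = 0) ->
  entry (a ** b) r s = \sum_(q <- S) entry a r q ** entry b q s.
Proof. exact: fmatrix_mul_funE. Qed.

Definition emat r s (c : C) : fmatrix :=
  mkmat (fun r' s' => if (r' == r) && (s' == s) then c else 0).

Lemma ematE r s c : (C_ r^-1%g `** C_ s) c ->
  forall r' s', entry (emat r s c) r' s' = if (r' == r) && (s' == s) then c else 0.
Proof.
move=> Cc r' s'; apply: mkmatE; split.
  exists [:: r; s] => p q; rewrite !inE; case: ifP => // /andP[-> ->].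
  by rewrite orbT.
move=> p q; case: ifP => [/andP[/eqP -> /eqP ->] //|_].
exact: (span_submodule _).1.
Qed.

Lemma emat_linear r s : linear_on (C_ r^-1%g `** C_ s) (emat r s).
Proof.
move=> c u v Cu Cv; apply: fmatrixP => p q; rewrite entry_linear !ematE //.
  by case: ifP => // _; rewrite scaler0 addr0.
exact: (span_submodule _).2.
Qed.

Lemma ematM r s t c d : (C_ r^-1%g `** C_ s) c -> (C_ s^-1%g `** C_ t) d ->
  emat r s c ** emat s t d = emat r t (c ** d).
Proof.
move=> Cc Cd; apply: fmatrixP => p q; rewrite (@entryM [:: s]) //.
  rewrite big_seq1 !ematE //; last by apply: (@gr_mulKS r s); apply: mem_span2.
  rewrite eqxx /= andbT; case: eqP => _ /=; case: eqP => _ //;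
    by rewrite ?numul0x ?numulx0.
by move=> i; rewrite inE ematE // => /negPf ->; rewrite andbF.
Qed.

Lemma fmatrix_decomp S a : uniq S -> supported S (entry a) ->
  a = \sum_(r <- S) \sum_(s <- S) emat r s (entry a r s).
Proof.
move=> uS aS; apply: fmatrixP => p q; rewrite entry_sum.
have E r : entry (\sum_(s <- S) emat r s (entry a r s)) p q =
    if p == r then entry a r q else 0.
  rewrite entry_sum (eq_bigr (fun s =>
    if (p == r) && (q == s) then entry a r s else 0)); last first.
    by move=> s _; apply: ematE; apply: entry_in.
  case: eqP => _; last by rewrite big1.
  have [qS|qS] := boolP (q \in S); last first.
    rewrite (supported_row _ aS) // big_seq big1 // => s sS.
    by case: eqP => // qs; rewrite qs sS in qS.
  rewrite (big_rem q) //= eqxx big_seq big1 ?addr0 // => s.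
  by rewrite mem_rem_uniq // inE eq_sym => /andP[/negPf ->].
under eq_bigr do rewrite E.
have [pS|pS] := boolP (p \in S); last first.
  rewrite aS ?(negPf pS) // big_seq big1 // => s sS.
  by case: eqP => // qs; rewrite qs sS in pS.
rewrite (big_rem p) //= eqxx big_seq big1 ?addr0 // => s.
by rewrite mem_rem_uniq // inE eq_sym => /andP[/negPf ->].
Qed.

Definition fmask (p : G -> G -> bool) a : fmatrix :=
  mkmat (fun r s => if p r s then entry a r s else 0).

Lemma fmaskE p a r s : entry (fmask p a) r s = if p r s then entry a r s else 0.
Proof.
apply: mkmatE; have [S _ aS] := entry_supp a; split.
  by exists S => i j ij; case: ifP => // _; apply: aS.
by move=> i j; case: ifP => _; [exact: entry_in | exact: (span_submodule _).1].
Qed.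

(** For [E] inside [C_1], these are the matrices that factor through [E] at the
    index [1]; for [E = C_t C_(t^-1)] they form the domain of translation by
    [t]. *)
Definition mset E : set fmatrix :=
  [set a | forall r s, (C_ r^-1%g `** E `** C_ s) (entry a r s)].

Lemma mset_submodule E : submodule (mset E).
Proof.
split=> [r s|c a b Ea Eb r s]; first exact: (span_submodule _).1.
by rewrite entry_linear; apply: (span_submodule _).2; [exact: Ea | exact: Eb].
Qed.

Lemma fmask_mset E p a : mset E a -> mset E (fmask p a).
Proof.
move=> Ea r s; rewrite fmaskE; case: ifP => // _.
exact: (span_submodule _).1.
Qed.

Definition unital_in_base E : Prop :=
  [/\ E `<=` C_ 1%g, C_ 1%g `** E = E & E `** C_ 1%g = E].

(** A matrix is a sum of matrix units, which are linear in their entry; so only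
    the entries that are products [u ** v] need to be considered. *)
Lemma mset_ind E (L R : G -> set C) (Q : set fmatrix) : submodule Q ->
  (forall r s, C_ r^-1%g `** E `** C_ s `<=` L r `** R s) ->
  (forall r s, L r `** R s `<=` C_ r^-1%g `** C_ s) ->
  (forall r s u v, L r u -> R s v -> Q (emat r s (u ** v))) ->
  mset E `<=` Q.
Proof.
move=> mQ sub entryLR QLR a Ea; have [S uS aS] := entry_supp a.
rewrite (fmatrix_decomp uS aS).
apply: submodule_sum => // r _; apply: submodule_sum => // s _.
suff /(_ _ (sub r s _ (Ea r s)))[] : L r `** R s `<=`
    [set c | (C_ r^-1%g `** C_ s) c /\ Q (emat r s c)] by [].
apply: span2_min => [|u v Lu Rv].
  split; first split; [exact: (span_submodule _).1 | |].
    rewrite (linear_on0 _ (@emat_linear r s)); first exact: mQ.1.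
    exact: (span_submodule _).1.
  move=> c u v [Cu Qu] [Cv Qv]; split; first exact: (span_submodule _).2.
  by rewrite emat_linear //; apply: mQ.2.
by split; [apply: entryLR; apply: mem_span2 | apply: QLR].
Qed.

Hypothesis symC : symmetrically_graded C.
Hypothesis domC : forall s t, D_ s `** D_ t = D_ t `** D_ s.

Lemma gr_dom_sub t : D_ t `<=` C_ 1%g.
Proof. by rewrite -(mulgV t); apply: gr_mulS. Qed.

Lemma gr_mul1l t : C_ 1%g `** C_ t = C_ t.
Proof.
apply/seteqP; split; first by rewrite -[X in _ `<=` C_ X]mul1g; apply: gr_mulS.
by rewrite -{1}symC; apply: mulsS => //; apply: gr_dom_sub.
Qed.

Lemma gr_mul1r t : C_ t `** C_ 1%g = C_ t.
Proof.
apply/seteqP; split; first by rewrite -[X in _ `<=` C_ X]mulg1; apply: gr_mulS.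
rewrite -{1}symC -mulsA; apply: mulsS => //.
by rewrite -{2}(invgK t); apply: gr_dom_sub.
Qed.

Lemma gr_dom1 : D_ 1%g = C_ 1%g.
Proof. by rewrite /gr_dom invg1 gr_mul1l. Qed.

Lemma unital_dom t : unital_in_base (D_ t).
Proof.
by split; [exact: gr_dom_sub | rewrite mulsA gr_mul1l | rewrite -mulsA gr_mul1r].
Qed.

Lemma unital_mul E F : unital_in_base E -> unital_in_base F ->
  unital_in_base (E `** F).
Proof.
move=> [E1 lE rE] [F1 lF rF]; split; last 2 first.
- by rewrite mulsA lE.
- by rewrite -mulsA rF.
by apply: subset_trans (mulsS E1 F1) _; rewrite gr_mul1l.
Qed.

Lemma mset_entry E r s : unital_in_base E ->
  C_ r^-1%g `** E `** C_ s `<=` C_ r^-1%g `** C_ s.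
Proof.
move=> [E1 _ _]; apply: mulsS => //.
by apply: subset_trans (mulsS (@subset_refl _ _) E1) _; rewrite gr_mul1r.
Qed.

Lemma emat_mset E r s c : unital_in_base E ->
  (C_ r^-1%g `** E `** C_ s) c -> mset E (emat r s c).
Proof.
move=> uE Ec p q; rewrite ematE; last exact: mset_entry Ec.
case: ifP => [/andP[/eqP -> /eqP ->] //|_]; exact: (span_submodule _).1.
Qed.

(** The product of two of these ideals is computed in [C_1]: the terms of a
    matrix product stay in [E F] because [E] absorbs [C_q C_(q^-1)];
    conversely, [c = u v] at [(r, s)] is the product of [u] at [(r, 1)] and [v] at
    [(1, s)]. *)
Lemma mset_mul E F : unital_in_base E -> unital_in_base F ->
  mset E `** mset F = mset (E `** F).
Proof.
move=> uE uF; have [E1 lE rE] := uE; have [F1 lF rF] := uF.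
have uEF := unital_mul uE uF.
apply/seteqP; split.
  apply: span2_min => [|a b Ea Fb r s]; first exact: mset_submodule.
  have [S uS aS] := entry_supp a.
  rewrite (@entryM S) //; last by move=> q; apply: supported_row.
  apply: submodule_sum => [|q _]; first exact: span_submodule.
  suff : (C_ r^-1%g `** E `** C_ q) `** (C_ q^-1%g `** F `** C_ s) `<=`
    C_ r^-1%g `** (E `** F) `** C_ s by apply; apply: mem_span2.
  rewrite !mulsA; apply: mulsS => //; apply: mulsS => //.
  by rewrite -!mulsA -{2}rE; do 2!apply: mulsS => //; apply: gr_dom_sub.
apply: (mset_ind (L := fun r => C_ r^-1%g `** E `** C_ 1%g)
    (R := fun s => C_ (1%g : G)^-1%g `** F `** C_ s)).
- exact: span_submodule.
- by move=> r s; rewrite invg1 -(mulsA _ E) rE lF !mulsA.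
- move=> r s; apply: subset_trans (@gr_mulKS r 1%g s).
  by apply: mulsS; apply: mset_entry.
move=> r s u v Eu Fv.
rewrite -(ematM (mset_entry uE Eu) (mset_entry uF Fv)).
by apply: mem_span2; apply: emat_mset.
Qed.

(** In an inverse semigroup, [t (u u^-1) = (tu) (tu)^-1 t]. *)
Lemma gr_slide t u : C_ t `** D_ u `<=` D_ (t * u)%g `** C_ t.
Proof.
rewrite -{1}symC -/(D_ t) -mulsA.
have h : C_ t `** D_ u `<=` D_ (t * u)%g `** C_ t.
  rewrite /gr_dom mulsA.
  apply: subset_trans (mulsS (@gr_mulS _ _ C t u) (@subset_refl _ _)) _.
  rewrite -{1}symC -mulsA; apply: mulsS => //.
  by rewrite -{2}[t](mulgK u); apply: gr_mulS.
apply: subset_trans (mulsS (@subset_refl _ _) h) _.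
by rewrite mulsA domC -mulsA {1}/gr_dom symC.
Qed.

(** Translation by [t] takes the entries of a matrix in its domain to admissible
    entries: the idempotent [D_(t^-1)] provides a factor [C_(t^-1)] on the left
    and [C_t] on the right, which absorb the translation of the indices. *)
Lemma gr_transport t u r s :
  C_ (t^-1 * r)^-1%g `** (D_ t^-1%g `** D_ u) `** C_ (t^-1 * s)%g `<=`
  C_ r^-1%g `** (D_ t `** D_ (t * u)%g) `** C_ s.
Proof.
have -> : D_ t^-1%g `** D_ u = C_ t^-1%g `** (C_ t `** D_ u `** C_ t^-1%g) `** C_ t.
  rewrite -{1}(symmetric_dom_idem symC) -mulsA (domC _ u).
  by rewrite /gr_dom !invgK !mulsA.
set a := (t^-1 * r)^-1%g; set b := (t^-1 * s)%g.
have -> : C_ a `** (C_ t^-1%g `** (C_ t `** D_ u `** C_ t^-1%g) `** C_ t) `** C_ b =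
    (C_ a `** C_ t^-1%g) `** (C_ t `** D_ u `** C_ t^-1%g) `** (C_ t `** C_ b).
  by rewrite !mulsA.
apply: mulsS; first apply: mulsS.
- have -> : (r^-1 = a * t^-1)%g by rewrite /a invgM invgK mulgK.
  exact: gr_mulS.
- rewrite domC /(D_ t) mulsA; apply: mulsS => //; exact: gr_slide.
- by rewrite -[X in _ `<=` C_ X](mulVKg t); apply: gr_mulS.
Qed.

Definition shift t a : fmatrix :=
  mkmat (fun r s => entry a (t^-1 * r)%g (t^-1 * s)%g).

Lemma mem_translate t (S : seq G) r :
  (r \in map (fun q => t * q)%g S) = ((t^-1 * r)%g \in S).
Proof. by rewrite -{1}(mulVKg t r) mem_map //; apply: mulgI. Qed.

Lemma shiftE t a r s : mset (D_ t^-1%g) a ->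
  entry (shift t a) r s = entry a (t^-1 * r)%g (t^-1 * s)%g.
Proof.
move=> Da; apply: mkmatE; split.
  have [S _ aS] := entry_supp a; exists (map (fun q => t * q)%g S) => i j ij.
  apply: aS; apply: contra ij => /andP[iS jS].
  by rewrite !mem_translate iS.
move=> i j; apply: (mset_entry (unital_mul (unital_dom t) (unital_dom 1%g))).
have := @gr_transport t t^-1%g i j (entry a (t^-1 * i)%g (t^-1 * j)%g).
rewrite mulgV symmetric_dom_idem //; apply; exact: Da.
Qed.

Lemma dom_mul_subl s t : mset (D_ s `** D_ t) `<=` mset (D_ s).
Proof.
move=> a Da i j; apply: mulsS (Da i j) => //; apply: mulsS => //.
apply: subset_trans (mulsS (@subset_refl _ _) (@gr_dom_sub t)) _.
by have [_ _ ->] := unital_dom s.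
Qed.

Lemma shift_in t u a : mset (D_ t^-1%g `** D_ u) a ->
  mset (D_ t `** D_ (t * u)%g) (shift t a).
Proof.
move=> Da r s; rewrite shiftE; last exact: dom_mul_subl Da.
by apply: gr_transport; apply: Da.
Qed.

Lemma shift_dom t a : mset (D_ t^-1%g) a -> mset (D_ t) (shift t a).
Proof.
move=> Da; apply: (@dom_mul_subl t 1%g); rewrite -(mulgV t); apply: shift_in.
by rewrite symmetric_dom_idem.
Qed.

Lemma shiftK t a : mset (D_ t^-1%g) a -> shift t^-1%g (shift t a) = a.
Proof.
move=> Da; apply: fmatrixP => r s.
rewrite shiftE; last by rewrite invgK; apply: shift_dom.
by rewrite shiftE // !invgK !mulKg.
Qed.

Lemma shift_linear t : linear_on (mset (D_ t^-1%g)) (shift t).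
Proof.
move=> c a b Da Db; apply: fmatrixP => r s.
by rewrite entry_linear !shiftE ?entry_linear //; apply: (mset_submodule _).2.
Qed.

Lemma mset_ideal E : unital_in_base E -> two_sided_ideal (mset E).
Proof.
move=> uE; have [E1 lE rE] := uE; split; first exact: mset_submodule.
have u1 : unital_in_base (C_ 1%g) by rewrite -gr_dom1; apply: unital_dom.
(* The whole algebra is mset C_1. *)
have T1 x : mset (C_ 1%g) x.
  by move=> r s; rewrite -mulsA gr_mul1l; apply: entry_in.
move=> a x Ex; split; [rewrite -lE|rewrite -rE]; rewrite -mset_mul //;
  exact: mem_span2.
Qed.

Lemma shiftM t a b : mset (D_ t^-1%g) a -> mset (D_ t^-1%g) b ->
  shift t (a ** b) = shift t a ** shift t b.
Proof.
move=> Da Db; apply: fmatrixP => r s.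
rewrite shiftE; last by have [] := (mset_ideal (unital_dom _)).2 a b Db.
have [S uS aS] := entry_supp a.
rewrite (@entryM S) //; last by move=> q; apply: supported_row.
rewrite (@entryM (map (fun q => t * q)%g S)); last first.
- move=> q qS; rewrite shiftE //; apply: (supported_row _ aS).
  by rewrite -mem_translate.
- by rewrite map_inj_uniq //; move=> i j /mulgI.
by rewrite big_map; apply: eq_bigr => q _; rewrite !shiftE // mulKg.
Qed.

Lemma shift_iso t : ideal_iso (mset (D_ t^-1%g)) (mset (D_ t)) (shift t).
Proof.
split; [split | exact: shift_linear | exact: shiftM].
- by move=> a; apply: shift_dom.
- move=> a b; rewrite !inE => Da Db /(congr1 (shift t^-1%g)).
  by rewrite !shiftK.
- move=> a Da; exists (shift t^-1%g a).
    by apply: shift_dom; rewrite invgK.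
  by rewrite -{1}(invgK t) shiftK // invgK.
Qed.

Lemma shift_image s t :
  shift s @` (mset (D_ s^-1%g) `** mset (D_ t)) =
  mset (D_ s) `** mset (D_ (s * t)%g).
Proof.
rewrite !mset_mul; try exact: unital_dom.
apply/seteqP; split; first by move=> _ [a Da <-]; apply: shift_in.
move=> a Da; exists (shift s^-1%g a).
  by rewrite -(mulKg s t); apply: shift_in; rewrite invgK.
by rewrite -{1}(invgK s) shiftK // invgK; apply: dom_mul_subl Da.
Qed.

Lemma shift_comp s t a : (mset (D_ t^-1%g) `** mset (D_ (s * t)^-1%g)) a ->
  shift s (shift t a) = shift (s * t) a.
Proof.
rewrite mset_mul; try exact: unital_dom.
move=> Da; have Dt := dom_mul_subl Da.
have Dst : mset (D_ (s * t)^-1%g) a by apply: (@dom_mul_subl _ t^-1%g); rewrite domC.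
have Ds : mset (D_ s^-1%g) (shift t a).
  apply: (@dom_mul_subl _ t); rewrite domC.
  by have := shift_in Da; rewrite invgM mulVKg.
by apply: fmatrixP => i j; rewrite !shiftE // invgM !mulgA.
Qed.

Definition shift_action : product_partial_action G fmatrix.
Proof.
exists (fun t => mset (D_ t)) shift.
- by move=> t; apply/mset_ideal/unital_dom.
- exact: shift_iso.
- apply/seteqP; split=> // a _ r s; rewrite gr_dom1 -mulsA gr_mul1l.
  exact: entry_in.
- move=> a; apply: fmatrixP => r s; rewrite shiftE ?invg1 ?mul1g //.
  by move=> i j; rewrite gr_dom1 -mulsA gr_mul1l; apply: entry_in.
- by move=> t; rewrite (mset_mul (unital_dom t) (unital_dom t)) symmetric_dom_idem.
- move=> s t; rewrite (mset_mul (unital_dom s) (unital_dom t)) domC.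
  by rewrite (mset_mul (unital_dom t) (unital_dom s)).
- exact: shift_image.
- exact: shift_comp.
Defined.

End Matrices.

(** * The skew group algebra of the translation action *)

Section SkewMatrixAlgebra.
Variables (k : comPzRingType) (G : groupType) (C : graded_algebra k G).
Hypothesis symC : symmetrically_graded C.
Hypothesis domC : forall s t,
  gr_dom C s `** gr_dom C t = gr_dom C t `** gr_dom C s.

Notation C_ := (gr C).
Notation D_ := (gr_dom C).
Notation P := (shift_action symC domC).
Notation T := (trivial_twist P).
Notation M := (skew_group_algebra P).
Implicit Types (r s t q g h : G) (m n : M).

Definition coef m g r s : C := entry (crossed_val m g) r s.

Lemma coef_in m g : mset (D_ g) (crossed_val m g).
Proof. exact: (crossed_in m g). Qed.

Lemma coefP m n : (forall g r s, coef m g r s = coef n g r s) -> m = n.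
Proof. by move=> mn; apply: crossedP => g; apply: fmatrixP => r s; apply: mn. Qed.

Lemma coef_linear (c : k) m n g r s :
  coef (c *: m + n) g r s = c *: coef m g r s + coef n g r s.
Proof.
have E : crossed_val (c *: m + n) g = c *: crossed_val m g + crossed_val n g.
  exact: (crossed_PE c m n g).
by rewrite /coef E entry_linear.
Qed.

Lemma tactV_shift g a : mset (D_ g) a -> tactV T g a = shift g^-1%g a.
Proof.
move=> Da; have Da' : mset (D_ g^-1%g^-1%g) a by rewrite invgK.
have {1}-> : a = tact T g (shift g^-1%g a).
  by rewrite /= -{1}(invgK g) shiftK.
by rewrite tactK //; apply: shift_dom.
Qed.

(** The partial inverse in the product of [a delta_g] and [b delta_h] only
    reindexes a sum: the entry is that of [a] times the translate of [b],
    although this translate need not be an element of the matrix algebra. *)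
Lemma skew_coef_entry S g h a b r s : mset (D_ g) a -> mset (D_ h) b ->
  uniq S -> (forall q, q \notin S -> entry a r q = 0) ->
  entry (crossed_coef T g h a b) r s =
  \sum_(q <- S) entry a r q ** entry b (g^-1 * q)%g (g^-1 * s)%g.
Proof.
move=> Da Db uS aS; have Da' : mset (D_ g^-1%g^-1%g) a by rewrite invgK.
rewrite /crossed_coef /= tactV_shift // shiftE //; last first.
  have [_ iD] := mset_ideal symC (unital_dom symC g^-1%g).
  by have [] := iD b _ (shift_dom symC domC Da').
rewrite (@entryM _ _ _ (map (fun q => g^-1 * q)%g S)).
- rewrite big_map; apply: eq_bigr => q _.
  by rewrite shiftE // invgK !mulVKg.
- by rewrite map_inj_uniq // => i j /mulgI.
- move=> q; rewrite mem_translate invgK => qS.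
  by rewrite shiftE // invgK mulVKg aS.
Qed.

Lemma coef_supp m : exists2 S : seq G, uniq S &
  forall g r s, ~~ [&& g \in S, r \in S & s \in S] -> coef m g r s = 0.
Proof.
have [S0 _ mS] := crossed_supp m.
have /choice[f fP] : forall g, exists S : seq G, supported S (entry (crossed_val m g)).
  by move=> g; have [S _ gS] := entry_supp (crossed_val m g); exists S.
pose S := S0 ++ flatten (map f S0).
exists (undup S) => [|g r s]; first exact: undup_uniq.
rewrite !mem_undup => nS; rewrite /coef.
have [gS|/mS ->] := boolP (g \in S0); last exact: entry0.
apply: fP; apply: contra nS => /andP[rg sg].
have sub x : x \in f g -> x \in S.
  by move=> xg; rewrite mem_cat; apply/orP; right; apply/flatten_mapP; exists g.
by rewrite (sub r) // (sub s) // mem_cat gS.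
Qed.

Definition coef_supported (S : seq G) m : Prop :=
  forall g r s, ~~ [&& g \in S, r \in S & s \in S] -> coef m g r s = 0.

Lemma coefM S m n t r s : uniq S -> coef_supported S m ->
  coef (m ** n) t r s =
  \sum_(g <- S) \sum_(q <- S)
    coef m g r q ** coef n (g^-1 * t)%g (g^-1 * q)%g (g^-1 * s)%g.
Proof.
move=> uS mS; rewrite /coef.
have mS0 g : g \notin S -> crossed_val m g = 0.
  move=> gS; apply: fmatrixP => i j.
  by rewrite -/(coef m g i j) mS ?entry0 // (negPf gS).
rewrite [crossed_val _ t](crossed_mulE (T := T) n t uS mS0) entry_sum.
apply: eq_bigr => g _; rewrite (@skew_coef_entry S) //.
- exact: coef_in.
- exact: coef_in.
- by move=> q qS; rewrite -/(coef m g r q) mS // (negPf qS) !andbF.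
Qed.

Fact skew_mask_in (p : G -> G -> G -> bool) m :
  (fun g => fmask (p g) (crossed_val m g)) \in crossed_pred T.
Proof.
apply/asboolP; split=> [|g]; last by apply: fmask_mset; apply: coef_in.
apply: (@sub_finite_set _ _ [set g | crossed_val m g <> 0]); last exact: crossed_fin.
move=> g /= mg m0; apply: mg; apply: fmatrixP => r s.
by rewrite fmaskE m0 entry0; case: ifP.
Qed.

Definition skew_mask p m : M := Crossed (skew_mask_in p m).

Lemma skew_maskE p m g r s :
  coef (skew_mask p m) g r s = if p g r s then coef m g r s else 0.
Proof. exact: fmaskE. Qed.

Lemma skew_mask_linear p : linear_on [set: M] (skew_mask p).
Proof.
move=> c m n _ _; apply: coefP => g r s; rewrite coef_linear !skew_maskE coef_linear.
by case: ifP => // _; rewrite scaler0 addr0.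
Qed.

Lemma skew_mask_gr p t m : gr M t m -> gr M t (skew_mask p m).
Proof.
move=> mt g gt; apply: fmatrixP => r s; rewrite -/(coef _ g r s) skew_maskE.
by rewrite /coef (mt g gt) entry0; case: ifP.
Qed.

Lemma skew_mask_supp p S m : coef_supported S m -> coef_supported S (skew_mask p m).
Proof. by move=> mS g r s /mS; rewrite skew_maskE => ->; case: ifP. Qed.

(** Multiplication by the matrix unit at [(1, 1)]. The entry at [(r, s)] of the
    coefficient of [delta_g] is in position [(r, g^-1 s)] of the matrix that
    represents it; so the condition on columns is [s = g]. *)
Definition base_vertex : multiplier [set: M].
Proof.
exists (skew_mask (fun _ r _ => r == 1%g))
       (skew_mask (fun g _ s => s == g)) => //.
- by move=> c m n _ _; apply: skew_mask_linear.
- by move=> c m n _ _; apply: skew_mask_linear.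
- move=> m n _ _; apply: coefP => t r s; have [S uS mS] := coef_supp m.
  rewrite skew_maskE !(@coefM S) //; last exact: skew_mask_supp.
  case: ifP => r1; last first.
    rewrite big1 // => g _; rewrite big1 // => q _.
    by rewrite skew_maskE r1 numul0x.
  by apply: eq_bigr => g _; apply: eq_bigr => q _; rewrite skew_maskE r1.
- move=> m n _ _; apply: coefP => t r s; have [S uS mS] := coef_supp m.
  rewrite skew_maskE !(@coefM S) //.
  case: ifP => st; last first.
    rewrite big1 // => g _; rewrite big1 // => q _; rewrite skew_maskE.
    by rewrite (inj_eq (mulgI _)) st numulx0.
  apply: eq_bigr => g _; apply: eq_bigr => q _; rewrite skew_maskE.
  by rewrite (inj_eq (mulgI _)) st.
- move=> m n _ _; apply: coefP => t r s; have [S uS mS] := coef_supp m.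
  rewrite !(@coefM S) //; last exact: skew_mask_supp.
  apply: eq_bigr => g _; apply: eq_bigr => q _; rewrite !skew_maskE.
  have -> : (g^-1 * q == 1)%g = (q == g).
    by rewrite -(mulVg g) (inj_eq (mulgI _)).
  by case: ifP => _; rewrite ?numulx0 ?numul0x.
Defined.

Notation eL := (mulL base_vertex).
Notation eR := (mulR base_vertex).

Lemma eLE m g r s : coef (eL m) g r s = if r == 1%g then coef m g r s else 0.
Proof. exact: skew_maskE. Qed.

Lemma eRE m g r s : coef (eR m) g r s = if s == g then coef m g r s else 0.
Proof. exact: skew_maskE. Qed.

(** In degree [t], an element of the corner has a single entry, at [(1, t)]. *)
Definition base_entry m : C := \sum_(t \in [set: G]) coef m t 1%g t.

Lemma base_entryE S m : uniq S -> (forall t, t \notin S -> coef m t 1%g t = 0) ->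
  base_entry m = \sum_(t <- S) coef m t 1%g t.
Proof.
move=> uS mS; rewrite /base_entry (fsbigE S) //.
  by apply: eq_bigl => q; rewrite in_setT.
by move=> q _ /mS.
Qed.

Lemma base_entry_linear : linear_on [set: M] base_entry.
Proof.
move=> c m n _ _; have [S uS mS] := coef_supp m; have [S' uS' nS] := coef_supp n.
have uU := undup_uniq (S ++ S').
have mU t : t \notin undup (S ++ S') -> coef m t 1%g t = 0.
  by rewrite mem_undup mem_cat => /norP[tS _]; rewrite mS // (negPf tS).
have nU t : t \notin undup (S ++ S') -> coef n t 1%g t = 0.
  by rewrite mem_undup mem_cat => /norP[_ tS]; rewrite nS // (negPf tS).
rewrite (base_entryE uU mU) (base_entryE uU nU) (base_entryE uU); last first.
  by move=> t tU; rewrite coef_linear mU // nU // scaler0 addr0.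
rewrite scaler_sumr -big_split; apply: eq_bigr => t _.
exact: coef_linear.
Qed.

Lemma gr_coef0 t m g r s : gr M t m -> g != t -> coef m g r s = 0.
Proof. by move=> mt gt; rewrite /coef (mt g gt). Qed.

Lemma base_entry_gr t m : gr M t m -> base_entry m = coef m t 1%g t.
Proof.
move=> mt; rewrite (@base_entryE [:: t]) ?big_seq1 // => g.
by rewrite inE => /(gr_coef0 _ _ mt).
Qed.

(** In degree [s], an element of the corner lives in column [s]; so one term of
    the matrix product survives. *)
Lemma base_entryM s t m n : gr M s m -> gr M t n -> corner base_vertex m ->
  corner base_vertex n -> base_entry (m ** n) = base_entry m ** base_entry n.
Proof.
move=> ms nt [_ Rm] _; rewrite (base_entry_gr ms) (base_entry_gr nt).
rewrite (base_entry_gr (gr_mul ms nt)).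
have [S uS mS] := coef_supp m; rewrite (coefM n _ _ _ uS mS).
have E g : g != s -> \sum_(q <- S)
    coef m g 1%g q ** coef n (g^-1 * (s * t))%g (g^-1 * q)%g (g^-1 * (s * t))%g = 0.
  by move=> gs; rewrite big1 // => q _; rewrite (gr_coef0 _ _ ms gs) numul0x.
have F q : q != s -> coef m s 1%g q = 0.
  by move=> /negPf qs; rewrite -Rm eRE qs.
have [sS|sS] := boolP (s \in S); last first.
  rewrite mS ?(negPf sS) // numul0x big_seq big1 // => g gS.
  by apply: E; apply: contraNneq sS => <-.
rewrite (big_rem s) //= [X in _ + X]big_seq [X in _ + X]big1 ?addr0; last first.
  by move=> g; rewrite mem_rem_uniq // inE => /andP[/E].
rewrite (big_rem s) //= big_seq big1 ?addr0; last first.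
  by move=> q; rewrite mem_rem_uniq // inE => /andP[/F ->]; rewrite numul0x.
by rewrite mulKg mulVg.
Qed.

Lemma corner_coef m g r s : corner base_vertex m -> (r != 1%g) || (s != g) ->
  coef m g r s = 0.
Proof.
move=> [Lm Rm] /orP[/negPf r1|/negPf sg]; first by rewrite -Lm eLE r1.
by rewrite -Rm eRE sg.
Qed.

Lemma coef_delta t a g r s : mset (D_ t) a ->
  coef (delta T t a) g r s = if g == t then entry a r s else 0.
Proof. by move=> Da; rewrite /coef (@deltaE _ _ _ T _ _ g Da); case: eqP. Qed.

Lemma dom_entry t : C_ (1%g : G)^-1%g `** D_ t `** C_ t = C_ t.
Proof. by rewrite invg1 mulsA (gr_mul1l symC) symC. Qed.

Lemma base_entry_bij t :
  set_bij (corner base_vertex `&` gr M t) (C_ t) base_entry.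
Proof.
split.
- move=> m [_ mt]; rewrite (base_entry_gr mt) -[X in X _]dom_entry.
  exact: (coef_in m t).
- move=> m n; rewrite !inE => -[cm mt] [cn nt].
  rewrite (base_entry_gr mt) (base_entry_gr nt) => mn; apply: coefP => g r s.
  have [gt|gt] := eqVneq g t; last by rewrite (gr_coef0 _ _ mt) // (gr_coef0 _ _ nt).
  have [rs|] := boolP ((r == 1%g) && (s == g)).
    by move: rs => /andP[/eqP -> /eqP ->]; rewrite gt.
  by rewrite negb_and => rs; rewrite !corner_coef.
- move=> c; rewrite -[X in X _]dom_entry => Dc.
  have Dm : mset (D_ t) (emat 1%g t c) by apply: emat_mset => //; apply: unital_dom.
  have mt := delta_gr (T := T) Dm.
  have E g r s : coef (delta T t (emat 1%g t c)) g r s =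
      if [&& g == t, r == 1%g & s == t] then c else 0.
    rewrite coef_delta //; case: eqP => _ //=.
    by rewrite ematE //; apply: mset_entry Dc => //; apply: unital_dom.
  exists (delta T t (emat 1%g t c)); last by rewrite (base_entry_gr mt) E !eqxx.
  split=> //; split; apply: coefP => g r s; rewrite ?eLE ?eRE !E.
    by case: (r == 1%g); rewrite ?andbF.
  have [//|sg] := eqVneq s g.
  by case: ifP => // /and3P[/eqP gt _ /eqP st]; rewrite gt st eqxx in sg.
Qed.

(** In the matrix picture, the unit at [(r, t^-1 s)] is the product of those at
    [(r, 1)], of degree [t], and [(1, t^-1 s)], of degree [1]. *)
Lemma delta_emat_factor t r s u v :
  (C_ r^-1%g `** C_ t) u -> (C_ t^-1%g `** C_ s) v ->
  (gr M t `** (eL @` gr M 1%g)) (delta T t (emat r s (u ** v))).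
Proof.
move=> Cu Cv.
have Du : mset (D_ t) (emat r t u).
  by apply: emat_mset; [|exact: unital_dom | rewrite -mulsA /gr_dom symC].
have Cv1 : (C_ (1%g : G)^-1%g `** D_ 1%g `** C_ (t^-1 * s)%g) v.
  by rewrite invg1 (gr_dom1 symC) !(gr_mul1l symC); apply: gr_mulS.
have Dv : mset (D_ 1%g) (emat 1%g (t^-1 * s)%g v).
  by apply: emat_mset => //; apply: unital_dom.
have Cv2 := mset_entry symC (unital_dom symC 1%g) Cv1.
have -> : delta T t (emat r s (u ** v)) =
    (delta T t (emat r t u) : M) ** eL (delta T 1%g (emat 1%g (t^-1 * s)%g v)).
  have -> : eL (delta T 1%g (emat 1%g (t^-1 * s)%g v)) =
      delta T 1%g (emat 1%g (t^-1 * s)%g v).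
    apply: coefP => g i j; rewrite eLE coef_delta // ematE //.
    by case: eqP => // _; case: ifP.
  rewrite (delta_mulE (T := T) Du Dv) mulg1; congr (delta T t).
  apply: fmatrixP => i j; rewrite (@skew_coef_entry [:: t]) //; last first.
    by move=> q; rewrite inE ematE // => /negPf ->; rewrite andbF.
  rewrite big_seq1 !ematE //; last by apply: (@gr_mulKS _ _ _ r t); apply: mem_span2.
  rewrite eqxx mulVg eqxx (inj_eq (mulgI _)) andbT /=.
  by case: eqP => _; case: eqP => _ //=; rewrite ?numul0x ?numulx0.
apply: mem_span2; first exact: delta_gr.
by exists (delta T 1%g (emat 1%g (t^-1 * s)%g v)) => //; apply: delta_gr.
Qed.

(** The previous factorization applies to all matrix units, because
    [C_(r^-1) D_t C_s] is [C_(r^-1) C_t] times [C_(t^-1) C_s]. *)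
Lemma base_vertex_full t : gr M t `<=` gr M t `** (eL @` gr M 1%g).
Proof.
move=> m mt; rewrite (gr_delta mt).
have mS := span_submodule [set u ** v | u in gr M t & v in eL @` gr M 1%g].
pose Q := [set a | mset (D_ t) a /\
  (gr M t `** (eL @` gr M 1%g)) (delta T t a)].
have mQ : submodule Q.
  have lin := @delta_linear _ _ _ T t.
  split=> [|c a b [Da Sa] [Db Sb]].
    split; first exact: (mset_submodule _).1.
    by rewrite (linear_on0 _ lin); [exact: mS.1 | exact: (mset_submodule _).1].
  split; first exact: (mset_submodule _).2.
  by rewrite lin //; apply: mS.2.
suff /(_ _ (coef_in m t))[] : mset (D_ t) `<=` Q by [].
apply: (mset_ind (L := fun r => C_ r^-1%g `** C_ t)
    (R := fun s => C_ t^-1%g `** C_ s)) => // [r s|r s|r s u v Cu Cv].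
- by rewrite /gr_dom !mulsA.
- exact: gr_mulKS.
split; last exact: delta_emat_factor.
apply: emat_mset; [exact: symC|exact: unital_dom|].
by rewrite /gr_dom (mulsA (C_ _)) -(mulsA _ _ (C_ s)); apply: mem_span2.
Qed.

Theorem symmetric_graded_equivalence : strongly_graded_equivalent C M.
Proof.
apply: (corner_equivalence (e := base_vertex) _ _ _ _ _ _ _ _
  base_entry_linear base_entryM base_entry_bij) => //.
- by move=> m; apply: coefP => g r s; rewrite !eLE; case: (r == 1%g).
- by move=> m; apply: coefP => g r s; rewrite !eRE; case: (s == g).
- move=> m; apply: coefP => g r s; rewrite !(eLE, eRE).
  by case: (r == 1%g); case: (s == g).
- by move=> t m; apply: skew_mask_gr.
- by move=> t m; apply: skew_mask_gr.
- exact: crossed_symmetric.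
- exact: base_vertex_full.
Qed.

End SkewMatrixAlgebra.

(** * Twisted partial actions *)

Theorem corollary7p12 (k : comPzRingType) (G : groupType) (A : nuAlgType k)
    (T : twisted_partial_action G A) :
  exists (B : nuAlgType k) (P : product_partial_action G B),
    strongly_graded_equivalent (crossed_product T) (skew_group_algebra P).
Proof.
exists (fmatrix (crossed_product T) : nuAlgType k).
exists (shift_action (crossed_symmetric T) (@crossed_dom_comm _ _ _ T)).
exact: symmetric_graded_equivalence.
Qed.
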